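(* Let $H>0$ and let $X=\{X(t),t\in\mathbb{R}_+,\mathbb{P}^x\}$ be an $H$-self-similar Markov process in $\mathbb{R}^d$ with transition probability $P(t,x,A)$. Assume the following two conditions. (B1) There exist positive constants $\beta$, $C$ and $a_1$ such that $$P(1,x,B(x,a)^c)\le C a^{-\beta}\quad\text{for all } x\in\mathbb{R}^d \text{ and } a>a_1.$$ (B2) For any sufficiently small $\varepsilon>0$ there exist positive constants $C_1$ and $C_2$ such that for all $r>0$ and all $x,y\in\mathbb{R}^d$ with $|x-y|\le r$, $$C_1\min\{1,r^{d+\varepsilon}\}\le P(1,x,B(y,r))\le C_2\min\{1,r^{d-\varepsilon}\}.$$ If $1\le Hd$, then for all $x\in\mathbb{R}^d$, with $\mathbb{P}^x$-probability one, $$\dim_{\mathrm H}X(E)=\frac1H\dim_{\mathrm H}E\quad\text{and}\quad\dim_{\mathrm P}X(E)=\frac1H\dim_{\mathrm P}E$$ for all Borel sets $E\subseteq\mathbb{R}_+$ (simultaneously).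
   Context: Standing assumptions: $X$ is a time-homogeneous Markov process with state space $\mathbb{R}^d$ ($\mathbb{R}_+=[0,\infty)$; $\mathbb{P}^x$ is the law of $X$ started at $x$). It has the strong Markov property, is separable, and its sample paths are almost surely right continuous with left limits. Its transition probability is $P(t,x,A)=\mathbb{P}^x(X(t)\in A)$. $X$ is called $H$-self-similar if $$P(t,x,A)=P(rt,r^Hx,r^HA)\quad\text{for all } t>0,\ r>0,\ x\in\mathbb{R}^d,\ A\in\mathcal{B}(\mathbb{R}^d).$$ Equivalently, for every $r>0$ the $\mathbb{P}^x$-distribution of $\{X(t),t\ge0\}$ equals the $\mathbb{P}^{r^Hx}$-distribution of $\{r^{-H}X(rt),t\ge0\}$. $B(x,r)$ is the ball of radius $r$ centered at $x$, and $B(x,a)^c=\{y\in\mathbb{R}^d:|y-x|\ge a\}$. $X(E)=\{X(t):t\in E\}$. $\dim_{\mathrm H}$ and $\dim_{\mathrm P}$ denote Hausdorff and packing dimension. *)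

(* Defs.v *)
From mathcomp Require Import all_boot all_order all_algebra.
From mathcomp Require Import all_classical all_reals all_analysis.
From mathcomp Require Import measurable_realfun.
Import Order.TTheory GRing.Theory Num.Theory.
Import numFieldNormedType.Exports.

Set Implicit Arguments.
Unset Strict Implicit.
Unset Printing Implicit Defensive.

Local Open Scope classical_set_scope.
Local Open Scope ring_scope.

(* The library norm on 'rV[R]_d is the max norm; balls and dimensions below use
   the Euclidean norm.  Both norms give the same open sets, hence the same
   Borel sets, limits and closed sets. *)
Definition eucl_norm (R : realType) (d : nat) (v : 'rV[R]_d) : R :=
  Num.sqrt (\sum_(i < d) v ord0 i ^+ 2).

Definition eucl_dist (R : realType) (d : nat) (x y : 'rV[R]_d) : R :=
  eucl_norm (x - y).

Definition real_dist (R : realType) (s t : R) : R := `|s - t|.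

Definition eucl_ball (R : realType) (d : nat) (x : 'rV[R]_d) (r : R) :
  set 'rV[R]_d := [set y | eucl_dist y x < r].

Definition borel (T : topologicalType) : set (set T) := <<s @open T >>.

Section Dimensions.
Variables (R : realType) (T : Type) (dist : T -> T -> R).

(* The outer maximum makes the diameter of the empty set 0 instead of -oo. *)
Definition diam (A : set T) : \bar R :=
  Order.max 0%E
    (ereal_sup [set z | exists x y, [/\ A x, A y & z = (dist x y)%:E]]).

Definition hausdorff_pre (s delta : R) (A : set T) : \bar R :=
  ereal_inf [set (\sum_(0 <= i <oo) (diam (U i) `^ s))%E |
    U in [set U : nat -> set T |
      A `<=` \bigcup_i U i /\ (forall i, (diam (U i) <= delta%:E)%E)]].

Definition hausdorff_measure (s : R) (A : set T) : \bar R :=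
  ereal_sup [set hausdorff_pre s delta A | delta in `]0, +oo[%classic].

Definition hausdorff_dim (A : set T) : \bar R :=
  ereal_inf [set s%:E |
    s in [set s : R | 0 < s /\ hausdorff_measure s A = 0%E]].

Definition cball (x : T) (r : R) : set T := [set y | dist y x <= r].

(* D ranges over all subsets of nat, so packings are finite or countable. *)
Definition packing_pre (s delta : R) (A : set T) : \bar R :=
  ereal_sup [set z | exists (D : set nat) (x : nat -> T) (r : nat -> R),
    [/\ forall i, D i -> A (x i) /\ 0 < r i <= delta,
        trivIset D (fun i => cball (x i) (r i)) &
        z = (\esum_(i in D) ((2 * r i) `^ s)%:E)%E]].

Definition packing_premeasure (s : R) (A : set T) : \bar R :=
  ereal_inf [set packing_pre s delta A | delta in `]0, +oo[%classic].

(* The premeasure is not countably subadditive: Tricot's second step. *)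
Definition packing_measure (s : R) (A : set T) : \bar R :=
  ereal_inf [set (\sum_(0 <= i <oo) packing_premeasure s (U i))%E |
    U in [set U : nat -> set T | A `<=` \bigcup_i U i]].

Definition packing_dim (A : set T) : \bar R :=
  ereal_inf [set s%:E |
    s in [set s : R | 0 < s /\ packing_measure s A = 0%E]].

End Dimensions.

(* Only the values at times t >= 0 of processes X and filtrations F indexed by
   R are used. *)
Section Processes.
Variables (R : realType) (d : nat).
Variables (dO : measure_display) (Omega : measurableType dO).
Variables (P : 'rV[R]_d -> probability Omega R).
Variables (X : R -> Omega -> 'rV[R]_d).
Variables (F : R -> set (set Omega)).

Definition transition (t : R) (x : 'rV[R]_d) (A : set 'rV[R]_d) : \bar R :=
  P x (X t @^-1` A).

Definition filtration : Prop :=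
  [/\ forall t : R, 0 <= t -> sigma_algebra setT (F t),
      forall t : R, 0 <= t -> F t `<=` measurable &
      forall s t : R, 0 <= s -> s <= t -> F s `<=` F t].

Record markov_process : Prop := MarkovProcess {
  mp_filtration : filtration;
  mp_adapted : forall (t : R) (B : set 'rV[R]_d), 0 <= t -> borel B ->
    F t (X t @^-1` B);
  mp_start : forall x, P x (X 0 @^-1` [set x]) = 1%E;
  mp_kernel : forall (t : R) (B : set 'rV[R]_d), 0 <= t -> borel B ->
    measurable_fun [set: g_sigma_algebraType (@open 'rV[R]_d)]
      (fun x : g_sigma_algebraType (@open 'rV[R]_d) => transition t x B);
  mp_markov : forall x (s t : R) A (B : set 'rV[R]_d), 0 <= s -> 0 <= t ->
    F s A -> borel B ->
    P x (A `&` X (s + t) @^-1` B) =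
    (\int[P x]_(w in A) transition t (X s w) B)%E }.

Definition stopping_time (tau : Omega -> \bar R) : Prop :=
  (forall w, (0 <= tau w)%E) /\
  (forall t : R, 0 <= t -> F t [set w | (tau w <= t%:E)%E]).

Definition stopped_sigma (tau : Omega -> \bar R) : set (set Omega) :=
  [set A | measurable A /\
    forall t : R, 0 <= t -> F t (A `&` [set w | (tau w <= t%:E)%E])].

Definition strong_markov : Prop :=
  forall tau : Omega -> \bar R, stopping_time tau ->
    let fin := [set w | (tau w < +oo)%E] in
    (forall B : set 'rV[R]_d, borel B ->
       stopped_sigma tau (fin `&` [set w | B (X (fine (tau w)) w)])) /\
    (forall x (t : R) A (B : set 'rV[R]_d), 0 <= t ->
       stopped_sigma tau A -> borel B ->
       P x (A `&` fin `&` [set w | B (X (fine (tau w) + t) w)]) =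
       (\int[P x]_(w in A `&` fin) transition t (X (fine (tau w)) w) B)%E).

(* Separability in the sense of Doob; `]a, b[ with a < 0 gives the relatively
   open intervals of [0, +oo[ containing 0. *)
Definition separable_process : Prop :=
  forall x, exists D : set R,
    [/\ countable D, D `<=` `[0, +oo[, `[0, +oo[ `<=` closure D &
      {ae P x, forall w, forall (a b : R) (K : set 'rV[R]_d), closed K ->
        (forall t : R, D t -> a < t < b -> K (X t w)) ->
        forall t : R, 0 <= t -> a < t < b -> K (X t w)}].

Definition cadlag : Prop :=
  forall x, {ae P x, forall w,
    (forall t : R, 0 <= t -> X s w @[s --> t^'+] --> X t w) /\
    (forall t : R, 0 < t -> cvg (X s w @[s --> t^'-]))}.

Definition self_similar (H : R) : Prop :=
  forall (t r : R) (x : 'rV[R]_d) (A : set 'rV[R]_d), 0 < t -> 0 < r ->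
    borel A ->
    transition t x A =
    transition (r * t) (r `^ H *: x) [set r `^ H *: y | y in A].

Definition tail_condition : Prop :=
  exists beta C a1 : R, [/\ 0 < beta, 0 < C, 0 < a1 &
    forall (x : 'rV[R]_d) (a : R), a1 < a ->
      (transition 1 x (~` eucl_ball x a) <= (C * a `^ (- beta))%:E)%E].

Definition ball_condition : Prop :=
  exists2 eps0 : R, 0 < eps0 & forall eps : R, 0 < eps < eps0 ->
    exists C1 C2 : R, [/\ 0 < C1, 0 < C2 &
      forall (r : R) (x y : 'rV[R]_d), 0 < r -> eucl_dist x y <= r ->
        ((C1 * Num.min 1 (r `^ (d%:R + eps)))%:E
           <= transition 1 x (eucl_ball y r)
           <= (C2 * Num.min 1 (r `^ (d%:R - eps)))%:E)%E].

End Processes.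

(* Main.v *)
Require Import Defs.
From mathcomp Require Import all_boot all_order all_algebra.
From mathcomp Require Import all_classical all_reals all_analysis.
From mathcomp Require Import measurable_realfun.
From mathcomp Require Import lra ring zify.
Import Order.TTheory GRing.Theory Num.Theory.
Import numFieldNormedType.Exports.
Local Open Scope classical_set_scope.
Local Open Scope ring_scope.

Set Implicit Arguments.
Unset Strict Implicit.
Unset Printing Implicit Defensive.

(* The identities come from two almost sure covering properties of the path at
   dyadic scales.
   (U) For gamma < H, the image of a dyadic interval of length 2^-n contains at
   most K points at mutual distance > 2^(-gamma n): by (B1), self-similarity and
   the Markov property at successive moves, K moves of that size within time
   2^-n have probability at most (c 2^(-kappa n))^K, which for K large beats the
   number 4^n of intervals.
   (L) For eta > 0, a ball of radius 2^(-Hn) is visited during at most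
   C 2^(eta n) of the first 4^n dyadic intervals of length 2^-n.  By (B2), a visit
   in the k-th interval after a previous one has probability at most
   c k^(-H(d - epsilon)); since Hd >= 1 the expected number M of further visits is
   at most C n 2^(2 H epsilon n), hence by the Markov property again p Q visits
   have probability at most (M / Q)^p, which for p large beats the polynomial
   (in 2^n) number of balls in a net.
   Both are proved along dyadic time grids with the simple Markov property and
   transferred to all times by right continuity.
   (U) bounds the dimensions of X(E) by those of E divided by gamma, and (L),
   applied to the inverse image, those of E by H times those of X(E). *)

(** * Hausdorff and packing measures under maps between scales *)

(** The null set must not depend on [E], so probability enters only through statements about the
    path at all dyadic levels, and arbitrary sets [E] are treated afterwards by a deterministic
    argument along one path. The exponents [gamma < H] and [eta > 0] run through countable families;
    the small loss they cause is absorbed because both dimensions are infima of exponents with null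
    measure. The path may jump, so no modulus of continuity is available: the image of a short
    interval need not be small. What survives is a bound on the number of mutually distant points.
    Counting separated points also serves both dimensions, since a maximal separated family is the
    set of centres of a cover as well as of a packing. In the escape estimate the distances [2 * a],
    [4 * a], [8 * a] come from two uses of the triangle inequality: a jump of [8 * a] has one end at
    least [4 * a] from any reference point, and a displacement of [4 * a] at some time forces one of
    at least [2 * a] to or from the position at the final time. *)

Section CoverInf.
Context {R : realType} {T : Type}.
Variables (Cl : set (set T)) (phi : set T -> \bar R).
Hypothesis phi_ge0 : forall A, (0 <= phi A)%E.

(** Outer measure built from a gauge [phi] on a class [Cl]. It is [hausdorff_pre] for the sets of
    diameter at most [delta], and [packing_measure] for the gauge [packing_premeasure] on all sets;
    countable subadditivity is thus proved once for both. *)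
Definition cover_inf (A : set T) : \bar R :=
  ereal_inf [set (\sum_(0 <= i <oo) phi (U i))%E |
    U in [set U : nat -> set T | A `<=` \bigcup_i U i /\ forall i, Cl (U i)]].

Lemma cover_inf_ge0 A : (0 <= cover_inf A)%E.
Proof.
by apply: le_ereal_inf_tmp => _ [U _ <-]; exact: nneseries_ge0.
Qed.

Lemma le_cover_inf A B : A `<=` B -> (cover_inf A <= cover_inf B)%E.
Proof.
move=> AB; apply: ereal_inf_le_tmp => _ [U [BU cU] <-]; exists U => //.
by split=> //; exact: subset_trans BU.
Qed.

Local Open Scope ereal_scope.

Lemma cover_inf_bigcup (A : (set T)^nat) :
  cover_inf (\bigcup_i A i) <= \sum_(0 <= i <oo) cover_inf (A i).
Proof.
have [[i ioo]|] := pselect (exists i, cover_inf (A i) = +oo).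
  rewrite (eseries_pinfty _ _ ioo) ?leey// => n _.
  by rewrite -ltNye (lt_le_trans _ (cover_inf_ge0 _)).
rewrite -forallNE => Aoo; apply/lee_addgt0Pr => _/posnumP[e].
rewrite (le_trans _ (epsilon_trick _ _ _))//; last first.
  by move=> n; exact: cover_inf_ge0.
pose P n (B : (set T)^nat) :=
  [/\ A n `<=` \bigcup_k B k, forall k, Cl (B k) &
  \sum_(0 <= k <oo) phi (B k) <= cover_inf (A n) + (e%:num / (2 ^ n.+1)%:R)%:E].
have [G PG] : {G : ((set T)^nat)^nat & forall n, P n (G n)}.
  apply: (@choice _ _ P) => n.
  have fin : cover_inf (A n) \is a fin_num.
    by rewrite ge0_fin_numE ?cover_inf_ge0// ltey; apply/eqP/Aoo.
  have en1 : (0 < e%:num / (2 ^ n.+1)%:R)%R by [].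
  have [_ [B [AB cB] <-] sB] := lb_ereal_inf_adherent en1 fin.
  by exists B; split=> //; exact/ltW.
have G_ge0 x : 0 <= (phi \o uncurry G) x by exact: phi_ge0.
(* A bijection between [nat] and pairs turns the double family into one cover of the union; the
   unordered sum over pairs is then taken row by row. *)
apply: (@le_trans _ _ (\esum_(i in setT) (phi \o uncurry G) i)).
  apply: ereal_inf_lbound => /=.
  have /card_esym/ppcard_eqP[f] := card_nat2.
  exists (uncurry G \o f).
    split => [t [i _]|i].
      have [AG _ _] := PG i; move=> /AG[j _ Gij].
      by exists (f^-1%FUN (i, j)) => //=; rewrite invK ?inE.
    by rewrite /=; case: (f i) => a b /=; have [] := PG a.
  rewrite -(esum_pred_image (phi \o uncurry G) _ xpredT) ?[fun=> _]set_true//.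
  by rewrite image_eq.
rewrite (_ : [set: nat * nat] = [set: nat] `*`` (fun=> [set: nat])); last first.
  by apply/seteqP; split=> // -[].
rewrite (_ : phi \o uncurry G = fun k => phi (G k.1 k.2)); last first.
  by apply/funext => -[].
rewrite -(@esum_esum _ _ _ setT (fun=> setT) (fun i j => phi (G i j)))//.
rewrite nneseries_esumT; last first.
  by move=> i; rewrite adde_ge0 ?cover_inf_ge0//.
apply: le_esum => i _.
rewrite -nneseries_esumT; last by move=> j; exact: (G_ge0 (i, j)).
by have [] := PG i.
Qed.

Lemma cover_inf_null (A : (set T)^nat) : (forall i, cover_inf (A i) = 0) ->
  cover_inf (\bigcup_i A i) = 0.
Proof.
move=> A0; apply/eqP; rewrite eq_le cover_inf_ge0 andbT.
by rewrite (le_trans (cover_inf_bigcup A))// eseries0.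
Qed.

Hypotheses (phi0 : phi set0 = 0) (Cl0 : Cl set0).

Lemma cover_inf_finite (A : set T) (n : nat) (U : nat -> set T) (c : \bar R) :
  A `<=` \bigcup_(i < n) U i -> (forall i, (i < n)%N -> Cl (U i)) ->
  (forall i, (i < n)%N -> phi (U i) <= c) -> cover_inf A <= n%:R%:E * c.
Proof.
move=> AU cU pU; pose V i := if (i < n)%N then U i else set0.
apply: (@le_trans _ _ (\sum_(0 <= i <oo) phi (V i))).
  apply: ereal_inf_lbound; exists V => //; split.
    move=> t /AU[i ni Ui]; exists i => //; rewrite /V ifT//.
  by move=> i; rewrite /V; case: ifPn => // /cU.
rewrite (nneseries_split 0 n)//.
rewrite add0n [X in _ + X]eseries0 ?adde0; last first.
  by move=> i ni _; rewrite /V ltnNge ni.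
rewrite big_mkord (@le_trans _ _ (\sum_(i < n) c))//.
  by apply: lee_sum => i _; rewrite /V ltn_ord pU.
by rewrite sumr_const card_ord mule_natl.
Qed.

End CoverInf.

(** * Powers of two and the choice of dyadic levels *)

Section PowersOfTwo.
Context {R : realType}.
Implicit Types x y : R.

Lemma pow2_gt0 x : 0 < 2 `^ x :> R.
Proof. exact: powR_gt0. Qed.

Lemma pow2D x y : 2 `^ (x + y) = 2 `^ x * 2 `^ y :> R.
Proof. by rewrite powRD// pnatr_eq0 implybT. Qed.

Lemma le_pow2 x y : x <= y -> 2 `^ x <= 2 `^ y :> R.
Proof. by apply: ler_powR; rewrite ler1n. Qed.

Lemma pow2_nat n : 2 `^ n%:R = 2 ^+ n :> R.
Proof. by rewrite powR_mulrn. Qed.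

Lemma pow2_gt1 x : 0 < x -> 1 < 2 `^ x :> R.
Proof.
move=> x0; rewrite ltNge; apply/negP => x1.
have ln2 : 0 < ln 2 :> R by rewrite ln_gt0// ltr1n.
have : 0 < ln (2 `^ x) :> R by rewrite ln_powR mulr_gt0.
by rewrite ltNge ln_le0.
Qed.

Lemma pow2N_small (c e : R) : 0 < c -> 0 < e ->
  exists n0, forall n, (n0 <= n)%N -> 2 `^ (- (c * n%:R)) <= e.
Proof.
move=> c0 e0; set N := Num.truncn e^-1; set M := Num.truncn (N.+1%:R / c).
exists M.+1 => n Mn; rewrite powRN invf_ple ?posrE ?pow2_gt0//.
have /ltW/le_trans -> // : e^-1 < N.+1%:R by exact: truncnS_gt.
rewrite (@le_trans _ _ (2 ^+ N.+1))//.
  by rewrite -natrX ler_nat ltnW// ltn_expl.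
rewrite -pow2_nat le_pow2// mulrC -ler_pdivrMr//.
by rewrite (le_trans (ltW (truncnS_gt _)))// ler_nat.
Qed.

Lemma pow2_absorb (c : R) (K : R) : 0 < c ->
  exists n0, forall n, (n0 <= n)%N -> K <= 2 `^ (c * n%:R).
Proof.
move=> c0; have e0 : 0 < (`|K| + 1)^-1 by rewrite invr_gt0 ltr_wpDl.
have [n0 h] := pow2N_small c0 e0; exists n0 => n /h.
rewrite powRN lef_pV2 ?posrE ?pow2_gt0 ?ltr_wpDl//; apply: le_trans.
by rewrite (le_trans (ler_norm _))// lerDl.
Qed.

Lemma scale_choice (a s u e : R) (n1 : nat) : 0 < a -> 0 < s -> 0 < e ->
  0 <= u -> u <= 2 `^ (- (a * n1%:R)) ->
  exists n, [/\ (n1 <= n)%N, u <= 2 `^ (- (a * n%:R)) &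
    2 `^ (- (a * s * n%:R)) <= 2 `^ (a * s) * u `^ s + e].
Proof.
move=> a0 s0 e0 u0 un1; have as0 : 0 < a * s by rewrite mulr_gt0.
have [n2 hn2] := pow2N_small as0 e0.
pose P n := (n <= maxn n1 n2)%N && (u <= 2 `^ (- (a * n%:R))).
have exP : exists n, P n by exists n1; rewrite /P leq_maxl.
have Pub n : P n -> (n <= maxn n1 n2)%N by case/andP.
case: (ex_maxnP exP Pub) => n /andP[nN un] nmax.
exists n; split=> //; first by apply: nmax; rewrite /P leq_maxl.
move: nN; rewrite leq_eqVlt => /predU1P[->|nN].
  rewrite (le_trans (hn2 _ _)) ?leq_maxr// lerDr.
  by rewrite mulr_ge0 ?powR_ge0.
have /ltW un1' : 2 `^ (- (a * n.+1%:R)) < u.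
  by rewrite ltNge; apply/negP => un'; have := nmax n.+1; rewrite /P nN un' ltnn => /(_ isT).
have : 2 `^ (- (a * n.+1%:R)) `^ s <= u `^ s.
  by apply: ge0_ler_powR => //; rewrite ?nnegrE ?powR_ge0// ltW.
rewrite -powRrM => us; rewrite (@le_trans _ _ (2 `^ (a * s) * u `^ s))//; last first.
  by rewrite lerDl ltW.
apply: le_trans (ler_wpM2l (powR_ge0 _ _) us); rewrite -pow2D.
by apply: le_pow2; rewrite -natr1; lra.
Qed.

End PowersOfTwo.

(** A separated family of largest size is a net: a point [r]-related to all its members could be put
    at its head. The bound [B] guarantees that a largest size exists. *)
Lemma max_separated (I : eqType) (r : rel I) (E : set I) (B : nat) :
  (forall s, {in s, forall x, E x} -> pairwise r s -> (size s <= B)%N) ->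
  exists s, [/\ {in s, forall x, E x}, pairwise r s &
    forall x, E x -> exists2 y, y \in s & ~~ r x y].
Proof.
move=> EB; pose P n := `[< exists s, [/\ {in s, forall x, E x}, pairwise r s & size s = n] >].
have exP : exists n, P n by exists 0%N; apply/asboolP; exists [::].
have Pub n : P n -> (n <= B)%N by move=> /asboolP[s [sE rs <-]]; exact: EB.
case: (ex_maxnP exP Pub) => n /asboolP[s [sE rs sn]] nmax.
exists s; split=> // x Ex; apply/not_exists2P => nxy.
suff : P n.+1 by move=> /nmax; rewrite ltnn.
apply/asboolP; exists (x :: s); split; last by rewrite /= sn.
  by move=> y; rewrite inE => /predU1P[->//|/sE].
rewrite /= rs andbT; apply/allP => y ys.
by have [/(_ ys)//|/negP] := nxy y; rewrite negbK.
Qed.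

(* Both spaces are seen through a common index set [I] (time), so that one
   statement covers the image map (f1 = id, f2 = path) and its multivalued
   inverse (f1 = path, f2 = id). *)
Definition scale_bound {R : realType} {I : eqType} {T1 T2 : Type}
  (dist1 : T1 -> T1 -> R) (dist2 : T2 -> T2 -> R) (f1 : I -> T1) (f2 : I -> T2)
  (a b eta : R) (E : set I) :=
  exists C n0, forall n, (n0 <= n)%N -> forall s : seq I,
    {in s, forall t, E t} ->
    {in s &, forall t t', dist1 (f1 t) (f1 t') <= 2 `^ (- (a * n%:R))} ->
    pairwise (fun t t' => 2 `^ (- (b * n%:R)) < dist2 (f2 t) (f2 t')) s ->
    (size s)%:R <= C * 2 `^ (eta * n%:R).

Section InfDim.
Context {R : realType}.
Local Open Scope ereal_scope.

(** Both dimensions are infima of this shape, so comparing them reduces to carrying null measure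
    from [s] to every exponent strictly above [theta * s]. *)
Lemma inf_null_le (m1 m2 : R -> \bar R) (theta : R) : (0 < theta)%R ->
  (forall s s', (0 < s)%R -> (theta * s < s')%R -> m1 s = 0 -> m2 s' = 0) ->
  ereal_inf [set s%:E | s in [set s : R | (0 < s)%R /\ m2 s = 0]] <=
  theta%:E * ereal_inf [set s%:E | s in [set s : R | (0 < s)%R /\ m1 s = 0]].
Proof.
move=> th0 m12; rewrite -lee_pdivrMl//; apply: le_ereal_inf_tmp => _ [s [s0 ms] <-].
rewrite lee_pdivrMl// -EFinM; apply/lee_addgt0Pr => e e0.
apply: ereal_inf_lbound; exists (theta * s + e)%R => //; split.
  by rewrite addr_gt0 ?mulr_gt0.
by apply: (m12 s) => //; rewrite ltrDl.
Qed.

End InfDim.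

(** * Diameters and Hausdorff null sets *)

Section DiamHausdorff.
Context {R : realType} {T : Type}.
Variable dist : T -> T -> R.
Local Open Scope ereal_scope.

Lemma diam_ge0 A : 0 <= diam dist A.
Proof. by rewrite /diam le_max lexx. Qed.

Lemma diam0 : diam dist set0 = 0.
Proof.
apply/eqP; rewrite eq_le diam_ge0 andbT ge_max lexx/=.
by apply: ge_ereal_sup => z [x [y [x0]]].
Qed.

Lemma le_dist_diam A x y : A x -> A y -> (dist x y)%:E <= diam dist A.
Proof.
move=> Ax Ay; rewrite le_max; apply/orP; right.
by apply: ereal_sup_ubound => /=; exists x, y.
Qed.

Lemma diam_le A (r : R) : (0 <= r)%R ->
  (forall x y, A x -> A y -> (dist x y <= r)%R) -> diam dist A <= r%:E.
Proof.
move=> r0 Ar; rewrite ge_max lee_fin r0; apply: ge_ereal_sup.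
by move=> _ [x [y [Ax Ay ->]]]; rewrite lee_fin Ar.
Qed.

Lemma hausdorff_preE s delta A : hausdorff_pre dist s delta A =
  cover_inf (fun U => diam dist U <= delta%:E) (fun U => diam dist U `^ s) A.
Proof. by []. Qed.

Lemma hausdorff_pre_ge0 s delta A : 0 <= hausdorff_pre dist s delta A.
Proof. by rewrite hausdorff_preE cover_inf_ge0// => U; exact: poweR_ge0. Qed.

Lemma hausdorff_measure_null s A : hausdorff_measure dist s A = 0 <->
  forall delta, (0 < delta)%R -> hausdorff_pre dist s delta A = 0.
Proof.
split=> [A0 delta d0|A0].
  apply/eqP; rewrite eq_le hausdorff_pre_ge0 andbT -A0 /hausdorff_measure.
  by apply: ereal_sup_ubound; exists delta => //=; rewrite in_itv/= d0.
rewrite /hausdorff_measure -[RHS](ereal_sup1 0); congr ereal_sup.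
apply/seteqP; split=> [_ [delta /= + <-]|_ ->].
  by rewrite in_itv/= andbT => /A0.
by exists 1%R; [rewrite /= in_itv/= ltr01|exact: A0].
Qed.

Lemma hausdorff_null_sub s A B : A `<=` B ->
  hausdorff_measure dist s B = 0 -> hausdorff_measure dist s A = 0.
Proof.
move=> AB /hausdorff_measure_null B0; apply/hausdorff_measure_null => r r0.
apply/eqP; rewrite eq_le hausdorff_pre_ge0 andbT -(B0 r r0).
by rewrite !hausdorff_preE le_cover_inf.
Qed.

Lemma hausdorff_null_bigcup s (A : (set T)^nat) :
  (forall i, hausdorff_measure dist s (A i) = 0) ->
  hausdorff_measure dist s (\bigcup_i A i) = 0.
Proof.
move=> A0; apply/hausdorff_measure_null => r r0; rewrite hausdorff_preE; apply: cover_inf_null.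
  by move=> U; exact: poweR_ge0.
by move=> i; have /hausdorff_measure_null := A0 i; exact.
Qed.

End DiamHausdorff.

(** * Hausdorff null sets between two scales *)

Section HausdorffTransfer.
Context {R : realType} {I : eqType} {T1 T2 : Type}.
Variables (dist1 : T1 -> T1 -> R) (dist2 : T2 -> T2 -> R).
Hypothesis dist2C : forall x y, dist2 x y = dist2 y x.
Hypothesis dist2_tri : forall x y z, dist2 x z <= dist2 x y + dist2 y z.
Variables (f1 : I -> T1) (f2 : I -> T2).

(** The balls of radius [rho] about a maximal [rho]-separated family cover the image, and their
    number is at most [B]. *)
Lemma cover_separated (W : set I) (rho : R) (B delta s : R) : 0 < s ->
  0 <= rho -> 2 * rho <= delta ->
  (forall t, {in t, forall x, W x} ->
     pairwise (fun x y => rho < dist2 (f2 x) (f2 y)) t -> (size t)%:R <= B) ->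
  (hausdorff_pre dist2 s delta (f2 @` W) <= (B * (2 * rho) `^ s)%:E)%E.
Proof.
move=> s0 rho0 rhod WB.
have WB' t : {in t, forall x, W x} ->
    pairwise (fun x y => rho < dist2 (f2 x) (f2 y)) t -> (size t <= Num.truncn B)%N.
  by move=> tW pt; rewrite truncn_ge_nat ?WB//; apply: le_trans (WB _ tW pt).
have [t [tW pt tmax]] := max_separated WB'.
rewrite hausdorff_preE.
(* [take 1 (drop l t)] holds the entry of rank [l], or nothing: unlike [nth], it needs no default
   element in [I], which may be empty. *)
pose U l := f2 @` W `&` [set z | exists2 x, x \in take 1 (drop l t) & dist2 z (f2 x) <= rho].
have dU l : (diam dist2 (U l) <= (2 * rho)%:E)%E.
  apply: diam_le => [|z z' [_ [x xl zx]] [_ [x' xl' zx']]]; first by rewrite mulr_ge0.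
  have xx' : x' = x.
    by case: drop xl xl' => [|y u]//=; rewrite take0 !inE => /eqP-> /eqP->.
  rewrite {}xx' dist2C in zx'.
  by rewrite (le_trans (dist2_tri _ (f2 x) _))// mulr2n mulrDl !mul1r lerD.
rewrite (@le_trans _ _ ((size t)%:R%:E * ((2 * rho) `^ s)%:E)%E)//; last first.
  by rewrite -EFinM lee_fin ler_wpM2r ?powR_ge0 ?WB.
apply: (@cover_inf_finite _ _ _ _ _ _ _ _ _ U) => //.
- by move=> A; exact: poweR_ge0.
- by rewrite diam0 poweR0r// gt_eqF.
- by rewrite diam0 lee_fin (le_trans _ rhod)// mulr_ge0.
- move=> _ [x Wx <-]; have [y yt] := tmax x Wx; rewrite -leNgt => xy.
  exists (index y t); first by rewrite /= index_mem.
  split; first by exists x.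
  exists y => //; rewrite (drop_nth y) ?index_mem// nth_index//= take0.
  by rewrite mem_head.
- by move=> l _; rewrite (le_trans (dU l)).
- move=> l _; rewrite -poweR_EFin; apply: gt0_ler_poweR; first exact: ltW.
  + by rewrite in_itv/= diam_ge0 leey.
  + by rewrite in_itv/= leey andbT lee_fin mulr_ge0.
  + exact: dU.
Qed.

Lemma hausdorff_transfer (a b eta s s' : R) (E : set I) :
  0 < a -> 0 < b -> 0 < s -> 0 < s' -> eta + a * s <= b * s' ->
  scale_bound dist1 dist2 f1 f2 a b eta E ->
  hausdorff_measure dist1 s (f1 @` E) = 0%E ->
  hausdorff_measure dist2 s' (f2 @` E) = 0%E.
Proof.
move=> a0 b0 s0 s'0 abs [C' [n0 hC']] /hausdorff_measure_null H1.
have [C C0 {C' hC'}hC] : exists2 C : R, 0 < C & forall n, (n0 <= n)%N -> forall t : seq I,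
    {in t, forall x, E x} ->
    {in t &, forall x y, dist1 (f1 x) (f1 y) <= 2 `^ (- (a * n%:R))} ->
    pairwise (fun x y => 2 `^ (- (b * n%:R)) < dist2 (f2 x) (f2 y)) t ->
    (size t)%:R <= C * 2 `^ (eta * n%:R).
  exists (`|C'| + 1) => [|n nn0 t tE t1 t2]; first by rewrite ltr_wpDl.
  rewrite (le_trans (hC' n nn0 t tE t1 t2))// ler_wpM2r ?powR_ge0//.
  by rewrite (le_trans (ler_norm _))// lerDl.
apply/hausdorff_measure_null => delta delta0.
apply/eqP; rewrite eq_le hausdorff_pre_ge0 andbT; apply/lee_addgt0Pr => e e0.
rewrite add0e.
have d20 : 0 < delta / 2 by rewrite divr_gt0.
have [n2 hn2] := pow2N_small b0 d20.
pose n1 := maxn n0 n2.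
pose K := C * 2 `^ s' * (2 `^ (a * s) + 1).
have K0 : 0 < K by rewrite !mulr_gt0 ?pow2_gt0// addr_gt0// pow2_gt0.
(* One [e'] bounds the sum of the chosen cover of the null set, the other the errors of
   [scale_choice], which are [e' / 2 ^ i.+1] on the piece [i]. *)
have [e' [e'0 e'E]] : exists e', 0 < e' /\ K * (e' + e') = e.
  exists (e / (2 * K)); split; first by rewrite divr_gt0// mulr_gt0.
  by field; rewrite gt_eqF.
have /H1 H1n := @pow2_gt0 R (- (a * n1%:R)).
have H1fin : hausdorff_pre dist1 s (2 `^ (- (a * n1%:R))) (f1 @` E) \is a fin_num.
  by rewrite H1n.
have [_ [U [EU dU] <-]] := lb_ereal_inf_adherent e'0 H1fin.
have H1n' := H1n; rewrite /hausdorff_pre in H1n'; rewrite {}H1n' add0e => sumU.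
have diamfin i : diam dist1 (U i) = (fine (diam dist1 (U i)))%:E.
  by rewrite fineK// ge0_fin_numE ?diam_ge0// (le_lt_trans (dU i)) ?ltry.
have P i : exists n, [/\ (n1 <= n)%N, (diam dist1 (U i) <= (2 `^ (- (a * n%:R)))%:E)%E &
    ((2 `^ (- (a * s * n%:R)))%:E <= (2 `^ (a * s))%:E * diam dist1 (U i) `^ s
       + (e' / (2 ^ i.+1)%:R)%:E)%E].
  have ei0 : 0 < e' / (2 ^ i.+1)%:R by rewrite divr_gt0// ltr0n expn_gt0.
  have u0 : 0 <= fine (diam dist1 (U i)) by rewrite fine_ge0 ?diam_ge0.
  have un : fine (diam dist1 (U i)) <= 2 `^ (- (a * n1%:R)) by rewrite -lee_fin -diamfin.
  have [n [nn1 un' us]] := scale_choice a0 s0 ei0 u0 un.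
  exists n; rewrite diamfin lee_fin; split=> //.
have {}P i := cid (P i); pose N i := sval (P i).
have fE : f2 @` E `<=` \bigcup_i (f2 @` (E `&` f1 @^-1` U i)).
  move=> _ [t Et <-]; have [|i _ Ui] := EU (f1 t); first by exists t.
  by exists i => //; exists t.
rewrite hausdorff_preE; apply: (le_trans (le_cover_inf _ _ fE)).
apply: (le_trans (cover_inf_bigcup _ _ _)) => [A|]; first exact: poweR_ge0.
have step i : (hausdorff_pre dist2 s' delta (f2 @` (E `&` f1 @^-1` U i)) <=
    K%:E * (diam dist1 (U i) `^ s + (e' / (2 ^ i.+1)%:R)%:E))%E.
  have [+ UiN NUi] : _ := svalP (P i); rewrite -/(N i) in UiN NUi *.
  rewrite geq_max => /andP[n0N n2N].
  have pk : (K%:E * (diam dist1 (U i) `^ s + (e' / (2 ^ i.+1)%:R)%:E) =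
    (K * (fine (diam dist1 (U i)) `^ s + e' / (2 ^ i.+1)%:R))%:E)%E.
    by rewrite diamfin poweR_EFin -EFinD -EFinM.
  apply: le_trans (@cover_separated _ (2 `^ (- (b * (N i)%:R)))
    (C * 2 `^ (eta * (N i)%:R)) _ _ s'0 _ _ _) _.
  - exact: powR_ge0.
  - by rewrite mulrC -ler_pdivlMr// hn2.
  - move=> t tW pt; apply: hC => //; first by move=> x /tW[].
    move=> x y /tW[_ Ux] /tW[_ Uy]; rewrite -lee_fin (le_trans _ UiN)//.
    exact: le_dist_diam.
  rewrite pk lee_fin powRM ?powR_ge0// -powRrM.
  move: NUi; rewrite diamfin poweR_EFin -EFinM -EFinD lee_fin => NUi.
  have u0 : 0 <= fine (diam dist1 (U i)) `^ s by exact: powR_ge0.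
  have ei0 : 0 <= e' / (2 ^ i.+1)%:R by rewrite divr_ge0// ltW.
  rewrite (_ : _ * _ * _ = C * 2 `^ s' *
    (2 `^ (eta * (N i)%:R) * 2 `^ (- (b * (N i)%:R) * s'))); last by ring.
  rewrite /K -!mulrA ler_pM2l// ler_pM2l ?pow2_gt0// -pow2D.
  apply: (@le_trans _ _ (2 `^ (- (a * s * (N i)%:R)))).
    apply: le_pow2; rewrite -subr_ge0.
    rewrite (_ : _ - _ = (b * s' - (eta + a * s)) * (N i)%:R); last by ring.
    by rewrite mulr_ge0// subr_ge0.
  apply: (le_trans NUi); set x := _ `^ s in u0 *; set y := e' / _ in ei0 *.
  rewrite -subr_ge0 (_ : _ - _ = 2 `^ (a * s) * y + x); last by ring.
  by rewrite addr_ge0// mulr_ge0// powR_ge0.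
apply: (le_trans (lee_nneseries _ (fun i _ => step i))) => [i _|].
  move=> _; exact: (hausdorff_pre_ge0 dist2 s' delta).
rewrite nneseriesZl; last first.
  by move=> i _; rewrite adde_ge0 ?poweR_ge0// lee_fin divr_ge0// ltW.
apply: (@le_trans _ _ (K%:E * (e'%:E + e'%:E))%E).
  rewrite lee_pmul2l//; apply: le_trans (epsilon_trick _ _ _) _ => //.
  - by move=> i; exact: poweR_ge0.
  - exact: ltW.
  - by rewrite leeD2r// ltW.
by rewrite -EFinD -EFinM e'E.
Qed.

End HausdorffTransfer.

Lemma geometric_tail_le {R : realFieldType} (q : R) (m n : nat) : 0 <= q < 1 ->
  \sum_(m <= i < n) q ^+ i <= q ^+ m / (1 - q).
Proof.
move=> /andP[q0 q1]; rewrite ler_pdivlMr ?subr_gt0//.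
have [mn|nm] := leqP m n; last first.
  by rewrite big_geq ?mul0r ?exprn_ge0// ltnW.
suff -> : (\sum_(m <= i < n) q ^+ i) * (1 - q) = q ^+ m - q ^+ n.
  by rewrite gerBl exprn_ge0.
rewrite -(subnKC mn); elim: (n - m)%N => [|k IHk].
  by rewrite addn0 big_geq// mul0r subrr.
by rewrite addnS big_nat_recr ?leq_addr//= mulrDl IHk exprS; ring.
Qed.

Lemma size_le_sum_count {I J : eqType} (p : J -> I -> bool) (u : seq I) (v : seq J) :
  {in u, forall t, exists2 y, y \in v & p y t} ->
  (size u <= \sum_(y <- v) count (p y) u)%N.
Proof.
elim: u => [//|t u IHu] h /=.
have {}IHu : (size u <= \sum_(y <- v) count (p y) u)%N.
  by apply: IHu => t' t'u; apply: h; rewrite inE t'u orbT.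
rewrite big_split/= -add1n leq_add//.
have [y yv pyt] := h t (mem_head _ _).
by rewrite (big_rem y)//= pyt.
Qed.

(* In an empty type [packing_pre] is a supremum over the empty set, i.e. -oo:
   hence the point [x0]. *)
Section Packing.
Context {R : realType} {T : Type} (x0 : T).
Variable dist : T -> T -> R.
Local Open Scope ereal_scope.

Lemma packing_pre_ge0 s delta A : 0 <= packing_pre dist s delta A.
Proof.
apply: ereal_sup_ubound => /=; exists set0, (fun=> x0), (fun=> 0%R).
by rewrite esum_set0; split=> //; exact: trivIset_set0.
Qed.

Lemma packing_premeasure_ge0 s A : 0 <= packing_premeasure dist s A.
Proof. by apply: le_ereal_inf_tmp => _ [r _ <-]; exact: packing_pre_ge0. Qed.

Lemma packing_measureE s A : packing_measure dist s A =
  cover_inf setT (packing_premeasure dist s) A.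
Proof.
rewrite /packing_measure /cover_inf; congr ereal_inf; congr image.
by apply/seteqP; split=> [U|U []].
Qed.

Lemma packing_measure_ge0 s A : 0 <= packing_measure dist s A.
Proof.
rewrite packing_measureE cover_inf_ge0// => U; exact: packing_premeasure_ge0.
Qed.

Lemma packing_null_sub s A B : A `<=` B ->
  packing_measure dist s B = 0 -> packing_measure dist s A = 0.
Proof.
move=> AB B0; apply/eqP; rewrite eq_le packing_measure_ge0 andbT -B0.
by rewrite !packing_measureE le_cover_inf.
Qed.

Lemma packing_null_bigcup s (A : (set T)^nat) :
  (forall i, packing_measure dist s (A i) = 0) ->
  packing_measure dist s (\bigcup_i A i) = 0.
Proof.
move=> A0; rewrite packing_measureE; apply: cover_inf_null.
  exact: packing_premeasure_ge0.
by move=> i; rewrite -packing_measureE.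
Qed.

Lemma packing_measure_cover0 s A (U : (set T)^nat) :
  A `<=` \bigcup_i U i -> (forall i, packing_premeasure dist s (U i) = 0) ->
  packing_measure dist s A = 0.
Proof.
move=> AU U0; apply/eqP; rewrite eq_le packing_measure_ge0 andbT.
apply: (@le_trans _ _ (\sum_(0 <= i <oo) packing_premeasure dist s (U i))).
  by apply: ereal_inf_lbound; exists U.
by rewrite eseries0.
Qed.

(** A finite sum has finite terms, so each piece of a suitable cover has bounded packing sums at one
    scale [delta]. This boundedness, rather than smallness, is what the transfer to the image starts
    from. *)
Lemma packing_measure_fin_cover s A : packing_measure dist s A < +oo ->
  exists2 U : (set T)^nat, A `<=` \bigcup_i U i &
    forall i, exists delta c : R, (0 < delta)%R /\
      packing_pre dist s delta (U i) <= c%:E.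
Proof.
move=> /ereal_inf_lt[_ [U AU <-] Uoo]; exists U => // i.
have : packing_premeasure dist s (U i) < +oo.
  apply: le_lt_trans Uoo; rewrite (nneseries_split 0 i.+1)//; last first.
    by move=> k _; exact: packing_premeasure_ge0.
  rewrite add0n big_nat_recr//= -addeA.
  rewrite addeCA leeDl// adde_ge0 ?sume_ge0 ?nneseries_ge0//.
  - by move=> k _; exact: packing_premeasure_ge0.
  - by move=> k _ _; exact: packing_premeasure_ge0.
move=> /ereal_inf_lt[_ [delta /= + <-] doo].
rewrite in_itv/= andbT => delta0.
exists delta, (fine (packing_pre dist s delta (U i))); split=> //.
by rewrite fineK// ge0_fin_numE ?packing_pre_ge0.
Qed.

End Packing.

(** * Packing null sets between two scales *)

Section PackingTransfer.
Context {R : realType} {I : eqType} {T1 T2 : Type} (i0 : I).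
Variables (dist1 : T1 -> T1 -> R) (dist2 : T2 -> T2 -> R).
Hypothesis dist1xx : forall x, dist1 x x = 0.
Hypothesis dist1C : forall x y, dist1 x y = dist1 y x.
Hypothesis dist1_tri : forall x y z, dist1 x z <= dist1 x y + dist1 y z.
Hypothesis dist2xx : forall x, dist2 x x = 0.
Variables (f1 : I -> T1) (f2 : I -> T2).

Lemma size_separated_le_packing (U : set T1) (v : seq I) (s delta sigma c : R) :
  0 < sigma -> sigma / 2 <= delta ->
  (packing_pre dist1 s delta U <= c%:E)%E ->
  {in v, forall t, U (f1 t)} ->
  pairwise (fun t t' => sigma < dist1 (f1 t) (f1 t')) v ->
  (size v)%:R * sigma `^ s <= c.
Proof.
move=> sigma0 sd Uc vU pv; rewrite -lee_fin; apply: le_trans Uc.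
apply: ereal_sup_ubound => /=.
exists `I_(size v), (fun i => f1 (nth i0 v i)), (fun=> sigma / 2); split.
- by move=> i iv; split; [exact/vU/mem_nth|rewrite divr_gt0].
- apply/trivIsetP => i j iv jv ij; apply/seteqP; split=> // x [xi xj].
  have sep k l : (k < size v)%N -> (l < size v)%N -> (k < l)%N ->
      sigma < dist1 (f1 (nth i0 v k)) (f1 (nth i0 v l)).
    by move=> kv lv kl; exact: (pairwiseP i0 pv).
  have : sigma < dist1 (f1 (nth i0 v i)) (f1 (nth i0 v j)).
    by move: ij; rewrite neq_ltn => /orP[/sep|/sep]; [exact|rewrite dist1C; exact].
  have := dist1_tri (f1 (nth i0 v i)) x (f1 (nth i0 v j)).
  by move: xi xj; rewrite /cball/= (dist1C _ x); lra.
- rewrite esum_fset//; last by move=> *; rewrite lee_fin powR_ge0.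
  rewrite (_ : 2 * (sigma / 2) = sigma); last by field.
  rewrite -fsbig_ord sumr_const card_ord.
  by rewrite EFinM mule_natl.
Qed.

(** Count in two stages: a maximal separated family in the first space has at most [c / sigma]^
    s[members by the packing bound, and the points of]u[near one member number at most]C * 2
    [^ (eta * n%:R)]. *)
Lemma size_separated_le (W : set I) (U : set T1) (a b eta s delta c C : R) (n : nat)
    (u : seq I) :
  f1 @` W `<=` U -> 0 <= C ->
  2 `^ (- (a * n%:R)) / 4 <= delta ->
  (packing_pre dist1 s delta U <= c%:E)%E ->
  (forall t : seq I, {in t, forall x, W x} ->
    {in t &, forall x y, dist1 (f1 x) (f1 y) <= 2 `^ (- (a * n%:R))} ->
    pairwise (fun x y => 2 `^ (- (b * n%:R)) < dist2 (f2 x) (f2 y)) t ->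
    (size t)%:R <= C * 2 `^ (eta * n%:R)) ->
  {in u, forall x, W x} ->
  pairwise (fun x y => 2 `^ (- (b * n%:R)) < dist2 (f2 x) (f2 y)) u ->
  (size u)%:R <= C * c * 2 `^ s * 2 `^ ((eta + a * s) * n%:R).
Proof.
move=> WU C0 nd Uc WC uW pu.
(* Half the scale, so that two points within [sigma] of the same centre are within [2]^ (- (a *
   n%:R))[of each other; the factor]2 [^ s] of the bound comes from here. *)
set sigma := 2 `^ (- (a * n%:R)) / 2.
have sigma0 : 0 < sigma by rewrite divr_gt0 ?pow2_gt0.
pose r t t' := sigma < dist1 (f1 t) (f1 t').
have rB v : {in v, forall x, [set` u] x} -> pairwise r v -> (size v <= size u)%N.
  move=> vu pv; apply: uniq_leq_size => //.
  apply: pairwise_uniq pv => x; rewrite /r dist1xx; apply/negbTE.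
  by rewrite -leNgt ltW.
have [v [vu pv vmax]] := max_separated rB.
have vW : (size v)%:R * sigma `^ s <= c.
  apply: (size_separated_le_packing sigma0 _ Uc _ pv); last first.
    by move=> t tv; apply: WU; exists t => //; exact/uW/vu.
  by apply: le_trans nd; rewrite /sigma; lra.
have uv : (size u <= \sum_(y <- v) count (fun t => ~~ r t y) u)%N.
  exact: size_le_sum_count.
have cnt y : (count (fun t => ~~ r t y) u)%:R <= C * 2 `^ (eta * n%:R).
  rewrite -size_filter; apply: WC.
  - by move=> t; rewrite mem_filter => /andP[_ /uW].
  - move=> t t'; rewrite !mem_filter /r -!leNgt => /andP[ty _] /andP[t'y _].
    rewrite (le_trans (dist1_tri _ (f1 y) _))// (dist1C (f1 y)).
    by rewrite (splitr (2 `^ _)) lerD.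
  - exact: pairwise_filter.
have c0 : 0 <= c by apply: le_trans vW; rewrite mulr_ge0 ?powR_ge0.
apply: (@le_trans _ _ ((size v)%:R * (C * 2 `^ (eta * n%:R)))).
  apply: (@le_trans _ _ (\sum_(y <- v) count (fun t => ~~ r t y) u)%N%:R).
    by rewrite ler_nat.
  rewrite natr_sum; apply: (le_trans (ler_sum _ (fun y _ => cnt y))).
  by rewrite mulr_natl big_const_seq count_predT iter_addr_0.
have -> : C * c * 2 `^ s * 2 `^ ((eta + a * s) * n%:R) =
    c * (2 `^ s * 2 `^ (a * s * n%:R)) * (C * 2 `^ (eta * n%:R)).
  by rewrite mulrDl pow2D; ring.
rewrite ler_wpM2r ?mulr_ge0 ?powR_ge0//.
have K1 : sigma `^ s * (2 `^ s * 2 `^ (a * s * n%:R)) = 1.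
  rewrite /sigma powRM ?invr_ge0 ?powR_ge0// -powRrM -[2^-1]powR_inv1// -powRrM.
  by rewrite -!pow2D (_ : _ + _ = 0) ?powRr0//; ring.
by rewrite -[leLHS]mulr1 -[X in _ * X <= _]K1 [leLHS]mulrA ler_wpM2r// mulr_ge0 ?powR_ge0.
Qed.

Lemma scale_level (b r : R) (n : nat) : 0 < b -> 0 < r <= 2 `^ (- (b * n%:R)) ->
  exists m, [/\ (n <= m)%N, 2 `^ (- (b * m.+1%:R)) < r & r <= 2 `^ (- (b * m%:R))].
Proof.
move=> b0 /andP[r0 rn].
have [k hk] := pow2N_small b0 (divr_gt0 r0 (ltr0n R 2)).
have exP : exists m, 2 `^ (- (b * m%:R)) < r.
  by exists k; rewrite (le_lt_trans (hk _ _))//; lra.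
case: (ex_minnP exP) => -[|m] mr mmin.
  have : 2 `^ (- (b * n%:R)) <= 2 `^ (- (b * 0%:R)).
    by rewrite le_pow2// lerN2 ler_wpM2l ?(ltW b0)// ler0n.
  by move=> /(le_trans rn)/(lt_le_trans mr); rewrite ltxx.
exists m; split=> //; last first.
  by rewrite leNgt; apply/negP => /mmin; rewrite ltnn.
rewrite leqNgt; apply/negP => mn.
have : 2 `^ (- (b * n%:R)) <= 2 `^ (- (b * m.+1%:R)).
  by rewrite le_pow2// lerN2 ler_wpM2l ?(ltW b0)// ler_nat.
by move=> /(le_trans rn)/(lt_le_trans mr); rewrite ltxx.
Qed.

Lemma packing_pre_transfer (W : set I) (U : set T1) (a b eta s s' delta c : R) :
  0 < a -> 0 < b -> 0 < s -> 0 < s' -> eta + a * s < b * s' -> 0 < delta ->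
  f1 @` W `<=` U -> (packing_pre dist1 s delta U <= c%:E)%E ->
  scale_bound dist1 dist2 f1 f2 a b eta W ->
  packing_premeasure dist2 s' (f2 @` W) = 0%E.
Proof.
move=> a0 b0 s0 s'0 abs delta0 WU Uc [C [n0 hC]].
apply/eqP; rewrite eq_le packing_premeasure_ge0 ?andbT; last exact: (f2 i0).
pose kappa := b * s' - (eta + a * s).
have kappa0 : 0 < kappa by rewrite subr_gt0.
pose q := 2 `^ (- kappa) : R.
have q01 : 0 <= q < 1.
  by rewrite powR_ge0/= /q powRN invf_lt1 ?pow2_gt0// pow2_gt1.
pose K2 := `|C| * `|c| * 2 `^ s.
pose K1 := 2 `^ s' * 2 `^ (b * s') : R.
apply/lee_addgt0Pr => e e0; rewrite add0e.
(* The value for [q ^+ n1] that brings the tail [K1 * K2 * q ^+ n1 / (1 - q)] below [e]; the added 1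
   keeps the denominator positive. *)
have e'0 : 0 < e * (1 - q) / (K1 * K2 + 1).
  have [_ q1] := andP q01.
  by rewrite divr_gt0 ?mulr_gt0 ?subr_gt0// ltr_wpDl ?mulr_ge0 ?powR_ge0.
have [n2 hn2] := pow2N_small kappa0 e'0.
have d40 : 0 < delta * 4 by rewrite mulr_gt0.
have [n3 hn3] := pow2N_small a0 d40.
pose n1 := maxn n0 (maxn n2 n3).
apply: (@le_trans _ _ (packing_pre dist2 s' (2 `^ (- (b * n1%:R))) (f2 @` W))).
  apply: ereal_inf_lbound; exists (2 `^ (- (b * n1%:R))) => //=.
  by rewrite in_itv/= pow2_gt0.
apply: ge_ereal_sup => _ [D [x [r [Dx trivD ->]]]].
have {}Dx i : exists n, D i -> exists t, [/\ W t, f2 t = x i, (n1 <= n)%N,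
    2 `^ (- (b * n%:R)) < r i & r i <= 2 `^ b * 2 `^ (- (b * n%:R))].
  have [Di|nDi] := pselect (D i); last by exists 0%N.
  have [[t Wt ftx] ri] := Dx i Di.
  have [m [n1m mr rm]] := scale_level b0 ri.
  exists m.+1 => _; exists t; split=> //; first exact: leqW.
  by rewrite -pow2D (le_trans rm)// le_pow2// -natr1; lra.
have {Dx}[lev Dx] := choice Dx.
have {}Dx i : exists t, D i -> [/\ W t, f2 t = x i, (n1 <= lev i)%N,
    2 `^ (- (b * (lev i)%:R)) < r i & r i <= 2 `^ b * 2 `^ (- (b * (lev i)%:R))].
  have [Di|nDi] := pselect (D i); last by exists i0.
  by have [t Wt] := Dx i Di; exists t.
have {Dx}[t Dx] := choice Dx.
have r0 i : D i -> 0 < r i.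
  by move=> /Dx[_ _ _ ri _]; rewrite (lt_trans (pow2_gt0 _) ri).
(* Otherwise the centre of ball [i] would lie in both balls. *)
have sep i j : D i -> D j -> i != j -> r j < dist2 (f2 (t i)) (f2 (t j)).
  move=> Di Dj ij; rewrite ltNge; apply/negP => xij.
  have [_ xi _ _ _] := Dx i Di; have [_ xj _ _ _] := Dx j Dj.
  move/trivIsetP : trivD => /(_ i j Di Dj ij); apply/eqP/set0P; exists (x i).
  split; rewrite /cball/=; last by rewrite -xi -xj.
  by rewrite dist2xx ltW// r0.
apply: ge_ereal_sup => _ [A [finA AD] <-].
rewrite fsbig_finite//=; set F : seq nat := finmap.enum_fset _.
have FD i : i \in F -> D i.
  move=> iF; apply: AD; apply/set_mem; rewrite -(in_fset_set finA); exact: iF.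
have cnt n : (n1 <= n)%N ->
    (count (fun i => lev i == n) F)%:R <= K2 * 2 `^ ((eta + a * s) * n%:R).
  rewrite !geq_max => /and3P[n0n n2n n3n].
  rewrite -size_filter -(size_map t).
  pose u := [seq i <- F | lev i == n].
  rewrite -/u.
  apply: (size_separated_le WU (normr_ge0 C) (delta := delta)) => //.
  - by rewrite ler_pdivrMr// hn3.
  - by rewrite (le_trans Uc)// lee_fin ler_norm.
  - move=> v vW v1 v2; rewrite (le_trans (hC n n0n v vW v1 v2))//.
    by rewrite ler_wpM2r ?powR_ge0// ler_norm.
  - by move=> y /mapP[i]; rewrite mem_filter => /andP[_ /FD/Dx[? _ _ _ _]] ->.
  - rewrite pairwise_map; apply/(pairwiseP 0%N) => i j; rewrite !inE => iu ju ij.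
    have := mem_nth 0%N iu; rewrite mem_filter => /andP[/eqP levi /FD Di].
    have := mem_nth 0%N ju; rewrite mem_filter => /andP[/eqP levj /FD Dj].
    have [_ _ _ rj _] := Dx _ Dj; rewrite levj in rj.
    apply: (lt_trans rj); apply: sep => //; rewrite nth_uniq ?ltn_eqF//.
    by rewrite filter_uniq// finmap.fset_uniq.
have term i : i \in F ->
    (2 * r i) `^ s' <= K1 * 2 `^ (- (b * s') * (lev i)%:R).
  move=> /FD Di; have [_ _ _ _ ri] := Dx _ Di.
  rewrite powRM ?(ltW (r0 _ Di))// /K1 -mulrA ler_wpM2l ?powR_ge0//.
  have -> : 2 `^ (b * s') * 2 `^ (- (b * s') * (lev i)%:R) =
      (2 `^ b * 2 `^ (- (b * (lev i)%:R))) `^ s' :> R.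
    rewrite powRM ?powR_ge0// -!powRrM; congr (_ * (_ `^ _)); ring.
  by apply: ge0_ler_powR; rewrite ?nnegrE ?mulr_ge0 ?powR_ge0 ?(ltW (r0 _ Di))// ltW.
rewrite sumEFin lee_fin.
apply: (@le_trans _ _ (\sum_(i <- F) K1 * 2 `^ (- (b * s') * (lev i)%:R))).
  by rewrite big_seq [leRHS]big_seq; apply: ler_sum.
rewrite -mulr_sumr.
pose N := (\max_(i <- F) lev i).+1.
have levN i : i \in F -> (n1 <= lev i < N)%N.
  by move=> iF; have [_ _ -> _ _] := Dx _ (FD _ iF); rewrite ltnS leq_bigmax_seq.
have -> : \sum_(i <- F) 2 `^ (- (b * s') * (lev i)%:R) =
    \sum_(n1 <= n < N) (count (fun i => lev i == n) F)%:R * 2 `^ (- (b * s') * n%:R) :> R.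
  under [RHS]eq_bigr do rewrite -sum1_count natr_sum mulr_suml big_mkcond.
  rewrite exchange_big/=; apply: eq_big_seq => i iF.
  rewrite (bigD1_seq (lev i)) ?iota_uniq ?mem_index_iota ?levN//= eqxx mul1r.
  by rewrite big1 ?addr0// => n; rewrite eq_sym => /negbTE ->.
apply: (@le_trans _ _ (K1 * \sum_(n1 <= n < N) K2 * q ^+ n)).
  rewrite ler_wpM2l ?mulr_ge0 ?powR_ge0// big_nat [leRHS]big_nat.
  apply: ler_sum => n /andP[n1n _].
  apply: (le_trans (ler_wpM2r (powR_ge0 _ _) (cnt n n1n))).
  rewrite -mulrA ler_wpM2l ?mulr_ge0 ?powR_ge0// -pow2D -powR_mulrn ?powR_ge0//.
  rewrite /q -powRrM le_pow2// /kappa le_eqVlt; apply/orP; left; apply/eqP; ring.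
rewrite -mulr_sumr mulrA.
have K12 : 0 <= K1 * K2 by rewrite !mulr_ge0 ?powR_ge0.
apply: (le_trans (ler_wpM2l K12 (geometric_tail_le n1 N q01))).
have [_ q1] := andP q01.
rewrite mulrA ler_pdivrMr ?subr_gt0//.
have : q ^+ n1 <= e * (1 - q) / (K1 * K2 + 1).
  rewrite -powR_mulrn ?powR_ge0// /q -powRrM mulNr hn2//.
  by rewrite !leq_max leqnn orbT.
rewrite ler_pdivlMr ?ltr_wpDl//; apply: le_trans.
by rewrite mulrC ler_wpM2l ?lerDl// exprn_ge0//; case/andP: q01.
Qed.

Lemma packing_transfer (a b eta s s' : R) (E : set I) :
  0 < a -> 0 < b -> 0 < s -> 0 < s' -> eta + a * s < b * s' ->
  scale_bound dist1 dist2 f1 f2 a b eta E ->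
  packing_measure dist1 s (f1 @` E) = 0%E ->
  packing_measure dist2 s' (f2 @` E) = 0%E.
Proof.
move=> a0 b0 s0 s'0 abs [C [n0 hC]] P1.
have [|U EU Ufin] := @packing_measure_fin_cover _ _ (f1 i0) dist1 s (f1 @` E).
  by rewrite P1 ltry.
apply: (@packing_measure_cover0 _ _ (f2 i0) _ _ _ (fun i => f2 @` (E `&` f1 @^-1` U i))).
  move=> _ [t Et <-]; have [|i _ Ui] := EU (f1 t); first by exists t.
  by exists i => //; exists t.
move=> i; have [delta [c [delta0 Uc]]] := Ufin i.
apply: (packing_pre_transfer a0 b0 s0 s'0 abs delta0 _ Uc).
  by move=> _ [t [_ Ut] <-].
exists C, n0 => n nn0 v vE v1 v2; apply: hC => //.
by move=> x /vE[].
Qed.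

End PackingTransfer.

(** * Euclidean distance and sigma-algebras *)

Section Euclid.
Context {R : realType} {d : nat}.
Implicit Types (x y z v : 'rV[R]_d) (r c : R).

Lemma eucl_norm_ge0 v : 0 <= eucl_norm v.
Proof. exact: sqrtr_ge0. Qed.

Lemma sqr_eucl_norm v : eucl_norm v ^+ 2 = \sum_(i < d) v ord0 i ^+ 2.
Proof. by rewrite sqr_sqrtr// sumr_ge0// => i _; rewrite sqr_ge0. Qed.

Lemma eucl_norm0 : eucl_norm (0 : 'rV[R]_d) = 0.
Proof.
by rewrite /eucl_norm big1 ?sqrtr0// => i _; rewrite mxE expr0n.
Qed.

Lemma coord_le_eucl_norm v i : `|v ord0 i| <= eucl_norm v.
Proof.
rewrite -(@ler_pXn2r _ 2)// ?nnegrE ?eucl_norm_ge0//.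
rewrite sqr_eucl_norm real_normK ?num_real// (bigD1 i)//= lerDl.
by rewrite sumr_ge0// => j _; rewrite sqr_ge0.
Qed.

Lemma eucl_norm_le v r : 0 <= r -> (forall i, `|v ord0 i| <= r) ->
  eucl_norm v <= d%:R * r.
Proof.
move=> r0 vr; rewrite -(@ler_pXn2r _ 2)// ?nnegrE ?eucl_norm_ge0 ?mulr_ge0//.
rewrite sqr_eucl_norm (@le_trans _ _ (\sum_(i < d) r ^+ 2))//.
  apply: ler_sum => i _; rewrite -real_normK ?num_real//.
  by rewrite ler_pXn2r ?nnegrE.
rewrite sumr_const card_ord exprMn -[leLHS]mulr_natl ler_wpM2r ?sqr_ge0//.
by rewrite -natrX ler_nat expnS expn1; case: (d) => // n; rewrite leq_pmulr.
Qed.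

Lemma eucl_normZ c v : 0 <= c -> eucl_norm (c *: v) = c * eucl_norm v.
Proof.
move=> c0; rewrite /eucl_norm.
under eq_bigr do rewrite mxE exprMn.
by rewrite -mulr_sumr sqrtrM ?sqr_ge0// sqrtr_sqr ger0_norm.
Qed.

Lemma eucl_normN v : eucl_norm (- v) = eucl_norm v.
Proof. by rewrite /eucl_norm; under eq_bigr do rewrite mxE sqrrN. Qed.

Lemma eucl_norm_eq0 v : eucl_norm v = 0 -> v = 0.
Proof.
move=> v0; apply/rowP => i; rewrite mxE; apply/eqP; rewrite -normr_le0 -v0.
exact: coord_le_eucl_norm.
Qed.

Lemma cauchy_schwarz_row x y :
  \sum_(i < d) x ord0 i * y ord0 i <= eucl_norm x * eucl_norm y.
Proof.
have [x0|x0] := eqVneq (eucl_norm x) 0.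
  by rewrite (eucl_norm_eq0 x0) eucl_norm0 mul0r big1// => i _; rewrite mxE mul0r.
have [y0|y0] := eqVneq (eucl_norm y) 0.
  by rewrite (eucl_norm_eq0 y0) eucl_norm0 mulr0 big1// => i _; rewrite mxE mulr0.
have := eucl_norm_ge0 x; rewrite le0r (negbTE x0)/= => {}x0.
have := eucl_norm_ge0 y; rewrite le0r (negbTE y0)/= => {}y0.
set a := eucl_norm x in x0 *; set b := eucl_norm y in y0 *.
(* AM-GM: [2 u v <= u^2 b/a + v^2 a/b] *)
apply: (@le_trans _ _ (\sum_(i < d)
    (x ord0 i ^+ 2 * (b / a / 2) + y ord0 i ^+ 2 * (a / b / 2)))).
  apply: ler_sum => i _; rewrite -subr_ge0.
  set u := x ord0 i; set v := y ord0 i.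
  rewrite (_ : _ - _ = (u * b - v * a) ^+ 2 / (2 * a * b)).
    by rewrite divr_ge0 ?sqr_ge0// !mulr_ge0// ltW.
  by field; rewrite !gt_eqF.
rewrite big_split/= -!mulr_suml -!sqr_eucl_norm -/a -/b le_eqVlt; apply/orP; left.
by apply/eqP; field; rewrite !gt_eqF.
Qed.

Lemma ler_eucl_normD x y : eucl_norm (x + y) <= eucl_norm x + eucl_norm y.
Proof.
rewrite -(@ler_pXn2r _ 2)// ?nnegrE ?addr_ge0 ?eucl_norm_ge0//.
rewrite sqrrD !sqr_eucl_norm.
under eq_bigr do rewrite mxE sqrrD -[_ *+ 2]mulr_natl.
rewrite !big_split/= lerD2r lerD2l -mulr_sumr -[leRHS]mulr_natl ler_pM2l//.
exact: cauchy_schwarz_row.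
Qed.

Lemma eucl_distxx x : eucl_dist x x = 0.
Proof. by rewrite /eucl_dist subrr eucl_norm0. Qed.

Lemma eucl_distC x y : eucl_dist x y = eucl_dist y x.
Proof. by rewrite /eucl_dist -opprB eucl_normN. Qed.

Lemma eucl_dist_tri x y z : eucl_dist x z <= eucl_dist x y + eucl_dist y z.
Proof.
by rewrite /eucl_dist (le_trans _ (ler_eucl_normD _ _))// addrA subrK.
Qed.

Lemma eucl_distZ c x y : 0 <= c -> eucl_dist (c *: x) (c *: y) = c * eucl_dist x y.
Proof. by move=> c0; rewrite /eucl_dist -scalerBr eucl_normZ. Qed.

Lemma scale_eucl_ballC c x r : 0 < c ->
  [set c *: y | y in ~` eucl_ball x r] = ~` eucl_ball (c *: x) (c * r).
Proof.
move=> c0; apply/seteqP; split=> [_ [y yr <-]|y yr].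
  by rewrite /eucl_ball/= eucl_distZ ?(ltW c0)// ltr_pM2l.
exists (c^-1 *: y); last by rewrite scalerA divff ?gt_eqF// scale1r.
rewrite /eucl_ball/= -(ltr_pM2l c0) -eucl_distZ ?(ltW c0)//.
by rewrite scalerA divff ?gt_eqF// scale1r.
Qed.

Lemma scale_eucl_ball c x r : 0 < c ->
  [set c *: y | y in eucl_ball x r] = eucl_ball (c *: x) (c * r).
Proof.
move=> c0; apply/seteqP; split=> [_ [y yr <-]|y yr].
  by rewrite /eucl_ball/= eucl_distZ ?(ltW c0)// ltr_pM2l.
exists (c^-1 *: y); last by rewrite scalerA divff ?gt_eqF// scale1r.
rewrite /eucl_ball/= -(ltr_pM2l c0) -eucl_distZ ?(ltW c0)//.
by rewrite scalerA divff ?gt_eqF// scale1r.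
Qed.

Lemma continuous_eucl_dist y : continuous (fun x => eucl_dist x y).
Proof.
move=> x; rewrite /eucl_dist /eucl_norm.
apply: continuous_comp; last exact: sqrt_continuous.
apply: (cvg_big add_continuous); first exact: nbhs_filter.
move=> i _.
have -> : (fun z : 'rV[R]_d => (z - y) ord0 i ^+ 2) =
    (fun z => (z ord0 i - y ord0 i) * (z ord0 i - y ord0 i)).
  by apply/funext => z; rewrite !mxE expr2.
have c : {for x, continuous (fun z : 'rV[R]_d => z ord0 i - y ord0 i)}.
  by apply: continuousB; [exact: coord_continuous|exact: cst_continuous].
by rewrite !mxE expr2; apply: (@continuousM _ 'rV[R]_d).
Qed.

Lemma open_eucl_ball x r : open (eucl_ball x r).
Proof.
rewrite (_ : eucl_ball x r = (fun y => eucl_dist y x) @^-1` [set z | z < r])//.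
apply: open_comp => [y _|]; first exact: continuous_eucl_dist.
exact: open_lt.
Qed.

Lemma borel_eucl_ball x r : borel (eucl_ball x r).
Proof. by apply: sub_sigma_algebra; exact: open_eucl_ball. Qed.

Lemma borel_eucl_ballC x r : borel (~` eucl_ball x r).
Proof. by rewrite -setTD; apply: sigma_algebraCD; exact: borel_eucl_ball. Qed.

End Euclid.

(** * Set operations in a sigma-algebra given as a set of sets *)

Section SigmaAlgebraOps.
Context {T : pointedType}.
Variable G : set (set T).
Hypothesis sG : sigma_algebra setT G.

(** The members of a filtration are bare set systems; the measurable type generated by [G] has the
    same measurable sets, and the measurability lemmas apply to it. *)
Let mG (A : set T) : G A <-> G.-sigma.-measurable A.
Proof. by rewrite measurable_g_measurableTypeE. Qed.

Lemma sigmaT : G setT. Proof. by apply/mG. Qed.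
Lemma sigma0 : G set0. Proof. by apply/mG. Qed.
Lemma sigmaI A B : G A -> G B -> G (A `&` B).
Proof. by move=> /mG ? /mG ?; apply/mG; exact: measurableI. Qed.
Lemma sigmaU A B : G A -> G B -> G (A `|` B).
Proof. by move=> /mG ? /mG ?; apply/mG; exact: measurableU. Qed.
Lemma sigmaD A B : G A -> G B -> G (A `\` B).
Proof. by move=> /mG ? /mG ?; apply/mG; exact: measurableD. Qed.
Lemma sigmaC A : G A -> G (~` A).
Proof. by move=> /mG ?; apply/mG; exact: measurableC. Qed.
Lemma sigma_bigcup (A : nat -> set T) (P : set nat) : (forall i, P i -> G (A i)) ->
  G (\bigcup_(i in P) A i).
Proof. by move=> GA; apply/mG; apply: bigcup_measurable => i /GA/mG. Qed.
Lemma sigma_bigsetU (A : nat -> set T) n : (forall i, (i < n)%N -> G (A i)) ->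
  G (\big[setU/set0]_(i < n) A i).
Proof. by move=> GA; apply/mG; apply: bigsetU_measurable => i _; exact/mG/GA. Qed.

Lemma sigma_eucl_dist {R : realType} {d : nat} (f g : T -> 'rV[R]_d) (r : R) :
  (forall B, borel B -> G (f @^-1` B)) -> (forall B, borel B -> G (g @^-1` B)) ->
  G [set w | eucl_dist (f w) (g w) < r].
Proof.
move=> Gf Gg; apply/mG.
have coord (h : T -> 'rV[R]_d) i : (forall B, borel B -> G (h @^-1` B)) ->
    measurable_fun [set: g_sigma_algebraType G] (fun w : g_sigma_algebraType G => h w ord0 i).
  move=> Gh; apply: (measurability _ (RGenOInfty.measurableE R)).
  move=> _ [_ [x -> <-]]; rewrite setTI.
  rewrite (_ : _ @^-1` _ = h @^-1` ((fun v : 'rV[R]_d => v ord0 i) @^-1` [set z | z > x])).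
    apply/mG/Gh; apply: sub_sigma_algebra; apply: open_comp => [y _|]; last exact: open_gt.
    exact: coord_continuous.
  by apply/seteqP; split=> v; rewrite /= in_itv/= andbT.
have mdist : measurable_fun [set: g_sigma_algebraType G]
    (fun w : g_sigma_algebraType G => eucl_dist (f w) (g w)).
  rewrite /eucl_dist /eucl_norm.
  apply: (@measurableT_comp _ _ _ _ _ _ (@Num.sqrt R)).
    by apply: continuous_measurable_fun; exact: sqrt_continuous.
  apply: measurable_sum => i; apply: measurable_funX.
  under eq_fun do rewrite !mxE.
  by apply: measurable_funB; exact: coord.
have := mdist measurableT [set z | z < r].
rewrite setTI; apply; apply: open_measurable; exact: open_lt.
Qed.

End SigmaAlgebraOps.

Lemma set_le_setC {R : realType} {T : Type} (g : T -> R) (r : R) :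
  [set w | r <= g w] = ~` [set w | g w < r].
Proof.
by apply/seteqP; split=> w /=; [rewrite leNgt => /negP|move/negP; rewrite -leNgt].
Qed.

(** * Escapes and returns of an adapted chain *)

Section FirstPassage.
Context {R : realType} {dO : measure_display} {Omega : measurableType dO}.
Variable mu : probability Omega R.
Variable G : nat -> set (set Omega).
Hypothesis sG : forall j, sigma_algebra setT (G j).
Hypothesis Gm : forall j, G j `<=` measurable.
Hypothesis Gle : forall i j, (i <= j)%N -> G i `<=` G j.
Local Open Scope ereal_scope.

(** Conditioning at the first index [j] with [V j]: the sets [seqDU V j] are disjoint, belong to
    [G j] and exhaust the union, so the bounds at fixed indices add up. *)
Lemma first_passage_le (V W : nat -> set Omega) (kappa : R) :
  (0 <= kappa)%R -> (forall j, G j (V j)) -> (forall j, measurable (W j)) ->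
  (forall j B, G j B -> B `<=` V j -> mu (B `&` W j) <= kappa%:E * mu B) ->
  mu (\bigcup_j (seqDU V j `&` W j)) <= kappa%:E * mu (\bigcup_j V j).
Proof.
move=> k0 GV mW VW.
have GD j : G j (seqDU V j).
  apply: (sigmaD (sG j)) => //; apply: (sigma_bigsetU (sG j)) => i ij.
  exact: (Gle (ltnW ij) (GV i)).
rewrite (seqDU_bigcup_eq V) measure_bigcup//=; last 2 first.
- by move=> j _; apply: measurableI => //; exact/Gm/GD.
- exact/trivIset_setIr/trivIset_seqDU.
rewrite measure_bigcup//=; last by move=> j _; exact/Gm/GD.
rewrite -nneseriesZl//; apply: lee_nneseries => // j _.
by apply: VW => // w [].
Qed.

Lemma seqDU_first (V : nat -> set Omega) (j : nat) w : V j w ->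
  exists i, [/\ (i <= j)%N, seqDU V i w & forall l, (l < i)%N -> ~ V l w].
Proof.
move=> Vj; have exP : exists j, `[< V j w >] by exists j; exact/asboolP.
case: (ex_minnP exP) => i /asboolP Vi imin.
have Vl l : (l < i)%N -> ~ V l w.
  by move=> li /asboolP/imin; rewrite leqNgt li.
exists i; split=> //; first exact/imin/asboolP.
by split=> //; rewrite -bigcup_mkord => -[l /= li]; exact: Vl.
Qed.

(** Markov's inequality for the number of events [B l] that occur, by integrating indicators. *)
Lemma multi_cover_le (n : nat) (B : nat -> set Omega) (C : set Omega) (q : nat) :
  (forall l, measurable (B l)) -> measurable C ->
  (forall w, C w -> (q <= \sum_(l < n) (w \in B l))%N) ->
  q%:R%:E * mu C <= \sum_(l < n) mu (B l).
Proof.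
move=> mB mC CB.
rewrite -(setIT C) -integral_indic// -ge0_integralZl_EFin//; last first.
  by apply/measurable_EFinP; exact: measurable_indic.
rewrite (eq_bigr (fun l : 'I_n => \int[mu]_w (\1_(B l) w)%:E)); last first.
  by move=> l _; rewrite integral_indic// setIT.
rewrite -ge0_integral_sum//; last first.
  by move=> l; apply/measurable_EFinP; exact: measurable_indic.
apply: ge0_le_integral => //.
- apply: emeasurable_funM; first exact: measurable_cst.
  by apply/measurable_EFinP; exact: measurable_indic.
- apply: emeasurable_sum => l.
  by apply/measurable_EFinP; exact: measurable_indic.
- move=> w _; rewrite -EFinM sumEFin lee_fin (eq_bigr (fun l : 'I_n => (w \in B l)%:R))//.
  rewrite indicE -natr_sum -natrM ler_nat.
  by case: (boolP (w \in C)) => [/set_mem/CB|]; rewrite ?muln1// muln0.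
Qed.

End FirstPassage.

Section Chain.
Context {R : realType} {d : nat} {dO : measure_display} {Omega : measurableType dO}.
Variable mu : probability Omega R.
Variable G : nat -> set (set Omega).
Hypothesis sG : forall j, sigma_algebra setT (G j).
Hypothesis Gm : forall j, G j `<=` measurable.
Hypothesis Gle : forall i j, (i <= j)%N -> G i `<=` G j.
Variable Y : nat -> Omega -> 'rV[R]_d.
Hypothesis GY : forall j B, borel B -> G j (Y j @^-1` B).

Let G_dist i j r : (i <= j)%N -> G j [set w | eucl_dist (Y j w) (Y i w) < r].
Proof.
move=> ij; apply: (sigma_eucl_dist (sG j)) => B bB; first exact: GY.
exact: (Gle ij (GY i bB)).
Qed.

Let G_ball j y r : G j [set w | eucl_dist (Y j w) y < r].
Proof. exact: (GY j (borel_eucl_ball y r)). Qed.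

Let Gsub i j A : (i <= j)%N -> G i A -> G j A.
Proof. by move=> ij; exact: Gle. Qed.

Let fin_pr B : measurable B -> exists2 v : R, 0 <= v & mu B = v%:E.
Proof.
move=> mB; exists (fine (mu B)); first exact: fine_ge0.
by rewrite fineK// fin_num_measure.
Qed.

(** * Successive large moves of the chain *)

Section Escape.
Variables (N : nat) (a p : R).
Hypotheses (a0 : 0 < a) (p0 : 0 <= p) (p2 : p <= 2^-1).
Variable n0 : nat.
Hypothesis increment : forall j k B, (n0 <= j)%N -> (j <= k)%N -> (k <= N)%N -> G j B ->
  (mu (B `&` [set w | (2 * a <= eucl_dist (Y k w) (Y j w))%R]) <= p%:E * mu B)%E.

Definition far (i j : nat) : set Omega :=
  if (i < j <= N)%N then [set w | 4 * a <= eucl_dist (Y j w) (Y i w)] else set0.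

(* [escapes K i]: at least [K] greedy moves up to time [N], the reference point
   being [Y i] at first, then the position where the last move ended. *)
Fixpoint escapes (K i : nat) : set Omega :=
  if K is K'.+1 then \bigcup_j (seqDU (far i) j `&` escapes K' j) else setT.

Lemma G_far i j : G j (far i j).
Proof.
rewrite /far; case: ifPn => [/andP[ij _]|_]; last exact: (sigma0 (sG j)).
by rewrite set_le_setC; apply: (sigmaC (sG j)); exact/G_dist/ltnW.
Qed.

Lemma G_seqDU (V : nat -> set Omega) j : (forall i, G i (V i)) -> G j (seqDU V j).
Proof.
move=> GV; apply: (sigmaD (sG j)) => //; apply: (sigma_bigsetU (sG j)) => i ij.
exact: (Gsub (ltnW ij) (GV i)).
Qed.

Lemma measurable_escapes K i : measurable (escapes K i).
Proof.
elim: K i => [|K IHK] i /=; first exact: measurableT.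
apply: bigcup_measurable => j _.
by apply: measurableI; [apply/Gm/G_seqDU; exact: G_far|exact: IHK].
Qed.

Let G_cut i A : G i A -> forall j, G j (if (i < j <= N)%N then A `&` far i j else set0).
Proof.
move=> GA j; case: ifPn => [/andP[ij _]|_]; last exact: (sigma0 (sG j)).
by apply: (sigmaI (sG j)); [exact: Gsub (ltnW ij) _|exact: G_far].
Qed.

(** Ottaviani's argument. After the first passage at distance [4 * a] from [Y i], either the chain
    moves by at least [2 * a] before time [N], or [Y N] is still at least [2 * a] away from [Y i];
    both are controlled by [increment]. *)
Lemma maximal_ineq i A : (n0 <= i)%N -> (i <= N)%N -> G i A ->
  (mu (\bigcup_j (A `&` far i j)) <= (2 * p)%:E * mu A)%E.
Proof.
move=> n0i iN GA.
pose V j := if (i < j <= N)%N then A `&` far i j else set0.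
have VE j : A `&` far i j = V j.
  by rewrite /V /far; case: ifP => // _; rewrite setI0.
pose W j := if (j <= N)%N then [set w | 2 * a <= eucl_dist (Y N w) (Y j w)] else set0.
have mW j : measurable (W j).
  rewrite /W; case: ifPn => // jN; apply: (Gm (j := N)).
  by rewrite set_le_setC; apply: (sigmaC (sG N)); exact/G_dist.
have VW : (mu (\bigcup_j (seqDU V j `&` W j)) <= p%:E * mu (\bigcup_j V j))%E.
  apply: (first_passage_le sG Gm Gle) => //; first exact: G_cut.
  move=> j B GB BV; rewrite /W.
  have [/andP[ij jN]|ij] := boolP (i < j <= N)%N.
    by rewrite jN; apply: increment => //; rewrite (leq_trans n0i)// ltnW.
  move: BV; rewrite /V (negbTE ij) subset0 => ->.
  by rewrite set0I !measure0 mule0.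
have mA : measurable A by exact: Gm GA.
have mVc : measurable (\bigcup_j V j).
  by apply: bigcup_measurable => j _; exact/Gm/G_cut.
have mD : measurable (\bigcup_j (seqDU V j `&` W j)).
  apply: bigcup_measurable => j _; apply: measurableI => //.
  by apply/Gm/G_seqDU; exact: G_cut.
rewrite (eq_bigcupr (fun j _ => VE j)).
have mAN : measurable (A `&` [set w | 2 * a <= eucl_dist (Y N w) (Y i w)]).
  by apply: measurableI => //; have := mW i; rewrite /W iN.
have Vsub : \bigcup_j V j `<=` \bigcup_j (seqDU V j `&` W j) `|`
    (A `&` [set w | 2 * a <= eucl_dist (Y N w) (Y i w)]).
  move=> w [j _ Vj]; have [k [_ sk _]] := seqDU_first Vj.
  have [Vk _] := sk; move: Vk; rewrite /V /far; case: ifPn => [/andP[ik kN] [Aw fk]|//].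
  have [Wk|nWk] := pselect (W k w); first by left; exists k.
  right; split=> //=; move: nWk; rewrite /W kN/= => /negP; rewrite -ltNge => kN'.
  have := eucl_dist_tri (Y k w) (Y N w) (Y i w).
  by move: fk; rewrite ik kN (eucl_distC (Y k w) (Y N w))/=; lra.
have : (mu (\bigcup_j V j) <= mu (\bigcup_j (seqDU V j `&` W j)) +
    mu (A `&` [set w | (2 * a <= eucl_dist (Y N w) (Y i w))%R]))%E.
  apply: le_trans (measureU2 _ mD mAN).
  exact: (le_measure mu (mem_set mVc) (mem_set (measurableU _ _ mD mAN)) Vsub).
have := increment n0i iN (leqnn N) GA.
move: VW; have [v v_ge0 ->] := fin_pr mVc; have [u u_ge0 ->] := fin_pr mD.
have [x x_ge0 ->] := fin_pr mA; have [y y_ge0 ->] := fin_pr mAN.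
rewrite -EFinD -!EFinM !lee_fin => uv yx vuy.
(* The inequality reads [v <= p * v + p * x]; [p <= 1/2] lets half of [v] be absorbed on the
   left. *)
have : v * p <= v * 2^-1 by rewrite ler_wpM2l.
by move: uv yx vuy; rewrite (mulrC p v) (mulrC p x); lra.
Qed.

(** The induction hypothesis is applied from the end of the first move, and the maximal inequality
    charges that move a factor [2 * p]. *)
Lemma escapes_le K i A : (n0 <= i)%N -> (i <= N)%N -> G i A ->
  (mu (A `&` escapes K i) <= ((2 * p) ^+ K)%:E * mu A)%E.
Proof.
elim: K i A => [|K IHK] i A n0i iN GA.
  by rewrite setIT expr0 mul1e.
pose V j := if (i < j <= N)%N then A `&` far i j else set0.
have VE j : A `&` far i j = V j.
  by rewrite /V /far; case: ifP => // _; rewrite setI0.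
have -> : A `&` escapes K.+1 i = \bigcup_j (seqDU V j `&` escapes K j).
  rewrite /= setI_bigcupr; apply: eq_bigcupr => j _.
  rewrite setIA; congr (_ `&` _).
  have <- : (fun j => A `&` far i j) = V by apply/funext.
  by rewrite seqDUIE /seqDU setIDA bigcup_mkord.
have p20 : 0 <= 2 * p by rewrite mulr_ge0.
apply: (@le_trans _ _ (((2 * p) ^+ K)%:E * mu (\bigcup_j V j))%E).
  apply: (first_passage_le sG Gm Gle).
  - exact: exprn_ge0.
  - exact: G_cut.
  - exact: measurable_escapes.
  - move=> j B GB BV; have [/andP[ij jN]|ij] := boolP (i < j <= N)%N.
      by apply: IHK => //; rewrite (leq_trans n0i)// ltnW.
    by move: BV; rewrite /V (negbTE ij) subset0 => ->; rewrite set0I !measure0 mule0.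
rewrite exprSr EFinM -muleA; apply: lee_wpmul2l; first by rewrite lee_fin exprn_ge0.
by rewrite -(eq_bigcupr (fun j _ => VE j)); exact: maximal_ineq.
Qed.

(* A jump of size [8a] between two times forces an escape of size [4a] from any
   reference point. *)
Lemma chain_escapes K i (c : nat -> nat) w : (i <= c 0%N)%N -> (c K <= N)%N ->
  (forall l, (l < K)%N -> (c l <= c l.+1)%N) ->
  (forall l, (l < K)%N -> 8 * a <= eucl_dist (Y (c l.+1) w) (Y (c l) w)) ->
  escapes K i w.
Proof.
elim: K i c => [//|K IHK] i c ic cN cmon cfar.
have c1 m : (m <= K)%N -> (c 1%N <= c m.+1)%N.
  by elim: m => [//|m IHm] mK; rewrite (leq_trans (IHm (ltnW mK)))// cmon.
have c1N := leq_trans (c1 K (leqnn K)) cN.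
have c01 := cmon 0%N isT.
have [j [jc Vj]] : exists j, (j <= c 1%N)%N /\ far i j w.
  have neq k : 4 * a <= eucl_dist (Y k w) (Y i w) -> k != i.
    by apply: contraTneq => ->; rewrite eucl_distxx -ltNge mulr_gt0.
  have [h|h] := leP (4 * a) (eucl_dist (Y (c 0%N) w) (Y i w)).
    exists (c 0%N); split=> //; rewrite /far ltn_neqAle ic eq_sym neq//=.
    by rewrite (leq_trans c01).
  have h1 : 4 * a <= eucl_dist (Y (c 1%N) w) (Y i w).
    have := eucl_dist_tri (Y (c 1%N) w) (Y i w) (Y (c 0%N) w).
    have := cfar 0%N isT; rewrite (eucl_distC (Y i w)); lra.
  by exists (c 1%N); split=> //; rewrite /far ltn_neqAle (leq_trans ic c01) eq_sym neq//= c1N.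
have [k [kj sk _]] := seqDU_first Vj; exists k => //; split=> //.
apply: (IHK k (c \o S)) => //=; first exact: leq_trans jc.
- by move=> l lK; apply: cmon.
- by move=> l lK; apply: cfar.
Qed.

End Escape.

(** * Number of time blocks in which the chain visits a ball *)

Section Hits.
Variables (y : 'rV[R]_d) (r : R) (b N : nat).
Hypotheses (b0 : (0 < b)%N).
Local Notation blk l := (l %/ b)%N.
Variable c : nat -> R.
Hypothesis stay : forall j B, (blk j < N)%N -> G j B ->
  B `<=` [set w | eucl_dist (Y j w) y < r] ->
  (mu (B `&` [set w | (2 * r <= eucl_dist (Y ((blk j).+1 * b)%N w) y)%R]) <= 2^-1%:E * mu B)%E.
Hypothesis return_le : forall j k B, (blk j < k < N)%N -> G j B ->
  B `<=` [set w | eucl_dist (Y j w) y < r] ->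
  (mu (B `&` [set w | (eucl_dist (Y (k.+1 * b)%N w) y < 2 * r)%R]) <= (c (k - blk j))%:E * mu B)%E.

Let ball j := [set w | eucl_dist (Y j w) y < r].

Definition hit (k : nat) : set Omega := \bigcup_(j in [set j | (blk j = k)%N]) ball j.

Definition hits (m n : nat) (w : Omega) : nat := (\sum_(m <= k < n) (w \in hit k))%N.

Lemma G_hit k j : (k < blk j)%N -> G j (hit k).
Proof.
move=> kj; apply: (sigma_bigcup (sG j)) => i /= ik; apply: Gsub (G_ball i y r).
apply: ltnW; have := kj; rewrite -ik => ij; rewrite ltnNge; apply/negP => ji.
by have := leq_div2r b ji; rewrite leqNgt ij.
Qed.

(** The predicate is arbitrary because the induction changes it: on [hit n] the condition on the
    shorter count is [P] after a successor. *)
Lemma G_hits (P : nat -> Prop) m n j : (n <= blk j)%N -> G j [set w | P (hits m n w)].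
Proof.
elim: n P => [|n IHn] P nj.
  rewrite (_ : mkset _ = if `[< P 0%N >] then setT else set0).
    by case: ifP => _; [exact: (sigmaT (sG j))|exact: (sigma0 (sG j))].
  case: asboolP => P0; apply/seteqP; split=> w //=; rewrite /hits big_geq//.
have [mn|nm] := leqP m n; last first.
  rewrite (_ : mkset _ = if `[< P 0%N >] then setT else set0).
    by case: ifP => _; [exact: (sigmaT (sG j))|exact: (sigma0 (sG j))].
  by case: asboolP => P0; apply/seteqP; split=> w //=; rewrite /hits big_geq//.
rewrite (_ : mkset _ = ([set w | P (hits m n w).+1] `&` hit n) `|`
   ([set w | P (hits m n w)] `\` hit n)).
  have Gn := G_hit nj.
  apply: (sigmaU (sG j)).
    by apply: (sigmaI (sG j)) => //; apply: (IHn (fun x => P x.+1)); exact: ltnW.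
  by apply: (sigmaD (sG j)) => //; apply: IHn; exact: ltnW.
have hE w : hits m n.+1 w = (hits m n w + (w \in hit n))%N by rewrite /hits big_nat_recr.
apply/seteqP; split=> w /=; rewrite hE.
  have [wn|wn] := boolP (w \in hit n).
    by rewrite addn1 => ?; left; split=> //; exact/set_mem.
  by rewrite addn0 => ?; right; split=> //; by move: wn; rewrite notin_setE.
move=> [[? /mem_set ->]|[? nw]]; first by rewrite addn1.
by rewrite memNset// addn0.
Qed.

Lemma measurable_hits (P : nat -> Prop) m n : measurable [set w | P (hits m n w)].
Proof. by apply: (Gm (j := (n * b)%N)); apply: G_hits; rewrite mulnK. Qed.

Lemma measurable_hit k : measurable (hit k).
Proof. by apply: (Gm (j := (k.+1 * b)%N)); apply: G_hit; rewrite mulnK. Qed.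

(** Replaces a visit at an unknown time of block [k] by a position at the fixed end of that block:
    by [stay], at least half of the mass that visits the ball is then still within [2 * r] of [y],
    and [return_le] bounds this part. Hence the factor 2. *)
Lemma hit_le j k A : (blk j < k < N)%N -> G j A -> A `<=` ball j ->
  (mu (A `&` hit k) <= (2 * c (k - blk j))%:E * mu A)%E.
Proof.
move=> /andP[jk kN] GA Aj.
have jlt l : blk l = k -> (j <= l)%N.
  move=> lk; apply: ltnW; rewrite ltnNge; apply/negP => /(leq_div2r b).
  by rewrite lk leqNgt jk.
pose V l := if blk l == k then A `&` ball l else set0.
have GV l : G l (V l).
  rewrite /V; case: eqP => [lk|_]; last exact: (sigma0 (sG l)).
  by apply: (sigmaI (sG l)); [exact: Gsub (jlt _ lk) GA|exact: G_ball].
have VE : A `&` hit k = \bigcup_l V l.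
  rewrite /hit setI_bigcupr; apply/seteqP; split=> w [l].
    by move=> /= lk Al; exists l => //; rewrite /V lk eqxx.
  by move=> _; rewrite /V; case: eqP => // lk Al; exists l.
pose W := [set w | 2 * r <= eucl_dist (Y (k.+1 * b)%N w) y].
pose W' := [set w | eucl_dist (Y (k.+1 * b)%N w) y < 2 * r].
have mW' : measurable W' by apply: (Gm (j := (k.+1 * b)%N)); exact: G_ball.
have WE : W = ~` W' by exact: set_le_setC.
have mW : measurable W by rewrite WE; exact: measurableC.
have VW : (mu (\bigcup_l (seqDU V l `&` W)) <= 2^-1%:E * mu (\bigcup_l V l))%E.
  apply: (first_passage_le sG Gm Gle (W := fun=> W)) => // l B GB.
  rewrite /V; case: eqP => [lk BV|_]; last first.
    by rewrite subset0 => ->; rewrite set0I !measure0 mule0.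
  rewrite /W -lk; apply: stay => //; first by rewrite lk.
  by move=> w /BV[].
have mA : measurable A by exact: Gm GA.
have mVc : measurable (\bigcup_l V l) by apply: bigcup_measurable => l _; exact/Gm/GV.
have mD : measurable (\bigcup_l (seqDU V l `&` W)).
  by apply: bigcup_measurable => l _; apply: measurableI => //; exact/Gm/G_seqDU.
have mAW : measurable (A `&` W') by exact: measurableI.
rewrite VE.
have : (mu (\bigcup_l V l) <= mu (\bigcup_l (seqDU V l `&` W)) + mu (A `&` W'))%E.
  apply: le_trans (measureU2 _ mD mAW).
  apply: le_measure; rewrite ?inE//; first exact: measurableU.
  move=> w [l _ Vl]; have [i [_ si _]] := seqDU_first Vl.
  have [Ww|nWw] := pselect (W w); first by left; exists i.
  right; split; last by apply: contrapT => ?; apply: nWw; rewrite WE.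
  by move: Vl; rewrite /V; case: eqP => // _ [].
have : (mu (A `&` W') <= (c (k - blk j))%:E * mu A)%E.
  by apply: return_le => //; rewrite jk.
move: VW; have [v v_ge0 ->] := fin_pr mVc; have [u u_ge0 ->] := fin_pr mD.
have [x x_ge0 ->] := fin_pr mA; have [z z_ge0 ->] := fin_pr mAW.
rewrite -EFinD -!EFinM !lee_fin -mulrA; move: (c _ * x) => q; lra.
Qed.

Section ManyHits.
Variables (Q : nat) (M : R).
Hypotheses (Q0 : (0 < Q)%N) (M0 : 0 <= M).
Hypothesis cM : forall k, (k < N)%N -> \sum_(k.+1 <= l < N) 2 * c (l - k) <= M.

Lemma hits_le j A : (blk j < N)%N -> G j A -> A `<=` ball j ->
  (mu (A `&` [set w | (Q <= hits (blk j).+1 N w)%N]) <= (M / Q%:R)%:E * mu A)%E.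
Proof.
move=> jN GA Aj; set k := blk j in jN *.
have mA : measurable A by exact: Gm GA.
have mH := measurable_hits (fun x => (Q <= x)%N) k.+1 N.
have mC : measurable (A `&` [set w | (Q <= hits k.+1 N w)%N]) by exact: measurableI.
pose B l := if (k < l < N)%N then A `&` hit l else set0.
have mB l : measurable (B l).
  by rewrite /B; case: ifP => // _; apply: measurableI => //; exact: measurable_hit.
have := @multi_cover_le R _ _ mu N B _ Q mB mC.
have -> : (forall w, (A `&` [set w | (Q <= hits k.+1 N w)%N]) w ->
    (Q <= \sum_(l < N) (w \in B l))%N) = True.
  apply/propext; split=> // _ w [Aw /= /leq_trans]; apply.
  rewrite /hits -(big_mkord xpredT (fun l => (w \in B l) : nat)).
  rewrite [leqRHS](big_cat_nat (n := k.+1))//= (leq_trans _ (leq_addl _ _))//.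
  rewrite big_nat [leqRHS]big_nat; apply: leq_sum => l /andP[kl lN].
  rewrite /B kl lN/=; have [/set_mem hl|//] := boolP (w \in hit l).
  by rewrite mem_set.
move=> /(_ I); have [q q_ge0 ->] := fin_pr mC.
have [x x_ge0 xE] := fin_pr mA; rewrite xE -!EFinM => qx.
have : (\sum_(l < N) mu (B l) <= (M * x)%:E)%E.
  apply: (@le_trans _ _ (\sum_(k.+1 <= l < N) (2 * c (l - k) * x)%:E)%E).
    rewrite -(big_mkord xpredT (fun l => mu (B l))) (big_cat_nat (n := k.+1))//=.
    rewrite big_nat big1 ?add0e => [|l /andP[_ lk]]; last first.
      by rewrite /B ltnNge -ltnS lk measure0.
    rewrite big_nat [leRHS]big_nat; apply: lee_sum => l /andP[kl lN].
    rewrite /B kl lN/= EFinM -xE; apply: hit_le => //.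
    by rewrite kl.
  by rewrite sumEFin lee_fin -mulr_suml ler_wpM2r// cM.
move=> /(le_trans qx); rewrite !lee_fin => {}qx.
by rewrite mulrAC ler_pdivlMr ?ltr0n// mulrC.
Qed.

(* Markov property at the [Q]-th hit block after [j]. *)
Lemma many_hits_le p j A : (blk j < N)%N -> G j A -> A `<=` ball j ->
  (mu (A `&` [set w | (p * Q <= hits (blk j).+1 N w)%N]) <=
    ((M / Q%:R) ^+ p)%:E * mu A)%E.
Proof.
have MQ0 : 0 <= M / Q%:R by rewrite divr_ge0.
elim: p j A => [|p IHp] j A jN GA Aj.
  rewrite expr0 mul1e (_ : [set w | _] = setT) ?setIT//.
  by apply/seteqP; split.
set k := blk j in jN *.
have mA : measurable A by exact: Gm GA.
pose C l := (k < blk l < N)%N.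
(* The count stops before the block of [l], so it is known at index [l]; with [Q.-1] earlier hits,
   the visit at [l] makes its block the [Q]-th one. *)
pose V l := if C l then A `&` [set w | hits k.+1 (blk l) w = Q.-1] `&` ball l else set0.
have GV l : G l (V l).
  rewrite /V /C; case: ifPn => [/andP[kl lN]|_]; last exact: (sigma0 (sG l)).
  apply: (sigmaI (sG l)); last exact: G_ball.
  apply: (sigmaI (sG l)); last by apply: (G_hits (fun x => x = Q.-1)).
  apply: Gsub GA; apply: ltnW; rewrite ltnNge; apply/negP => /(leq_div2r b).
  by rewrite leqNgt kl.
pose W l := [set w | (p * Q <= hits (blk l).+1 N w)%N].
have mW l : measurable (W l) by exact: (measurable_hits (fun x => (p * Q <= x)%N)).
have hcat m n w : (m <= n)%N -> (n < N)%N -> w \in hit n ->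
    hits m N w = (hits m n w + (hits n.+1 N w).+1)%N.
  move=> mn nN wn; rewrite /hits (big_cat_nat (n := n))//=; last exact: ltnW.
  by rewrite (big_ltn nN) wn.
have Vhits l w : V l w -> C l /\ hits k.+1 N w = (Q + hits (blk l).+1 N w)%N.
  rewrite /V; case: ifPn => // Cl [[_ /= hQ] wl]; split=> //.
  have /andP[kl lN] := Cl; rewrite (hcat _ (blk l))//; last first.
    by apply: mem_set; exists l.
  by rewrite hQ; move: Q0; clear; lia.
have Vex w : A w -> (Q <= hits k.+1 N w)%N -> exists l, V l w.
  move=> Aw wQ.
  have exP : exists n, (Q <= hits k.+1 n w)%N by exists N.
  case: (ex_minnP exP) => n wn nmin.
  have nN : (n <= N)%N by exact: nmin.
  have kn : (k.+1 < n)%N.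
    rewrite ltnNge; apply/negP => nk; move: wn; rewrite /hits big_geq//.
    by rewrite leqNgt Q0.
  case: n => // n in wn nmin nN kn *.
  have wn1 : (hits k.+1 n w < Q)%N by rewrite ltnNge; apply/negP => /nmin; rewrite ltnn.
  have hE : hits k.+1 n.+1 w = (hits k.+1 n w + (w \in hit n))%N by rewrite /hits big_nat_recr.
  move: wn; rewrite hE; have [hn|] := boolP (w \in hit n); last first.
    by rewrite addn0 leqNgt wn1.
  rewrite addn1 => Qn; have [l /= ln wl] := set_mem hn.
  exists l; rewrite /V /C ln -ltnS kn nN; split=> //; split=> //=.
  by move: wn1 Qn; clear; lia.
have mV : measurable (\bigcup_l V l) by apply: bigcup_measurable => l _; exact/Gm/GV.
have VW : (mu (\bigcup_l (seqDU V l `&` W l)) <=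
    ((M / Q%:R) ^+ p)%:E * mu (\bigcup_l V l))%E.
  apply: (first_passage_le sG Gm Gle) => // [|l B GB BV]; first exact: exprn_ge0.
  have [Cl|nCl] := boolP (C l).
    apply: IHp => //; first by case/andP: Cl.
    by move=> w /BV; rewrite /V Cl => -[].
  move: BV; rewrite /V (negbTE nCl) subset0 => ->.
  by rewrite set0I !measure0 mule0.
have mH := measurable_hits (fun x => (p.+1 * Q <= x)%N) k.+1 N.
apply: (@le_trans _ _ (mu (\bigcup_l (seqDU V l `&` W l)))).
  apply: le_measure; rewrite ?inE.
  - exact: measurableI.
  - by apply: bigcup_measurable => l _; apply: measurableI => //; exact/Gm/G_seqDU.
  move=> w [Aw /= wp].
  have [|l Vl] := Vex w Aw; first by rewrite (leq_trans _ wp)// leq_pmull.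
  have [i [_ si _]] := seqDU_first Vl; exists i => //; split=> //.
  have [Ci hi] := Vhits i w (subset_seqDU si).
  by move: wp; rewrite hi mulSn leq_add2l.
apply: (le_trans VW); rewrite exprSr EFinM -muleA.
apply: lee_wpmul2l; first by rewrite lee_fin exprn_ge0.
apply: le_trans (hits_le jN GA Aj); apply: le_measure; rewrite ?inE//.
  by apply: measurableI => //; exact: (measurable_hits (fun x => (Q <= x)%N)).
move=> w [l _ Vl]; have [Cl hl] := Vhits l w Vl; split.
  by move: Vl; rewrite /V Cl => -[[]].
by rewrite /= -/k hl leq_addr.
Qed.

(** No starting position near [y] is given: the first visit supplies it and uses up one hit block,
    whence the strict inequality. *)
Lemma total_hits_le p :
  (mu [set w | (p * Q < hits 0 N w)%N] <= ((M / Q%:R) ^+ p)%:E)%E.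
Proof.
have MQ0 : 0 <= M / Q%:R by rewrite divr_ge0.
pose V l := if (blk l < N)%N then ball l else set0.
have GV l : G l (V l).
  by rewrite /V; case: ifPn => _; [exact: G_ball|exact: (sigma0 (sG l))].
pose W l := [set w | (p * Q <= hits (blk l).+1 N w)%N].
have mW l : measurable (W l) by exact: (measurable_hits (fun x => (p * Q <= x)%N)).
have mV : measurable (\bigcup_l V l) by apply: bigcup_measurable => l _; exact/Gm/GV.
have VW : (mu (\bigcup_l (seqDU V l `&` W l)) <=
    ((M / Q%:R) ^+ p)%:E * mu (\bigcup_l V l))%E.
  apply: (first_passage_le sG Gm Gle) => // [|l B GB]; first exact: exprn_ge0.
  rewrite /V; case: ifPn => [lN BV|_]; first exact: many_hits_le.
  by rewrite subset0 => ->; rewrite set0I !measure0 mule0.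
apply: (@le_trans _ _ (mu (\bigcup_l (seqDU V l `&` W l)))); last first.
  apply: (le_trans VW); rewrite -[leRHS]mule1; apply: lee_wpmul2l.
    by rewrite lee_fin exprn_ge0.
  exact: probability_le1.
apply: le_measure; rewrite ?inE.
- exact: (measurable_hits (fun x => (p * Q < x)%N)).
- by apply: bigcup_measurable => l _; apply: measurableI => //; exact/Gm/G_seqDU.
move=> w /= wp.
have [l Vl] : exists l, V l w.
  apply: contrapT => /forallNP nV; move: wp; rewrite /hits big_nat big1// => k /andP[_ kN].
  rewrite memNset//= => -[l /= lk wl]; apply: (nV l).
  by rewrite /V lk kN.
have [i [_ si imin]] := seqDU_first Vl; exists i => //; split=> //.
have Vi := subset_seqDU si.
have iN : (blk i < N)%N by move: Vi; rewrite /V; case: ifP.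
have first_hit : (hits 0 (blk i).+1 w <= 1)%N.
  rewrite /hits big_nat_recr//= big_nat big1 ?add0n ?leq_b1// => k /andP[_ ki].
  rewrite memNset//= => -[l1 /= lk wl]; apply: (imin l1).
    by rewrite ltnNge; apply/negP => /(leq_div2r b); rewrite lk leqNgt ki.
  by rewrite /V lk (ltn_trans ki iN).
have hE : hits 0 N w = (hits 0 (blk i).+1 w + hits (blk i).+1 N w)%N.
  by rewrite /hits -big_cat_nat.
by move: wp first_hit; rewrite /W/= hE; clear; lia.
Qed.

End ManyHits.
End Hits.
End Chain.

(** * Increment bounds for the self-similar process *)

Section Lattice.
Context {R : realType} {d : nat}.
Implicit Types (v : 'rV[R]_d) (h : R) (B : nat).

(** The shift by [B] lets natural numbers below [2 * B] index the points of a cube: a finite type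
    for union bounds, and a countable one when [B] varies. *)
Definition lattice_point h B (z : 'I_d -> nat) : 'rV[R]_d :=
  \row_i (h * ((z i)%:R - B%:R)).

Lemma lattice_approx v h B : 0 < h -> (forall i, `|v ord0 i| < h * B%:R) ->
  exists z : {ffun 'I_d -> 'I_(2 * B)},
    eucl_dist v (lattice_point h B (fun i => z i : nat)) <= d%:R * h.
Proof.
move=> h0 vB.
pose u i := v ord0 i / h + B%:R.
have uB i : 0 <= u i < (2 * B)%:R.
  have := vB i; rewrite ltr_norml => /andP[l1 l2].
  have : - B%:R <= v ord0 i / h by rewrite ler_pdivlMr// mulNr mulrC ltW.
  have : v ord0 i / h < B%:R by rewrite ltr_pdivrMr// mulrC.
  by rewrite /u mulSn mul1n natrD => ? ?; apply/andP; split; lra.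
have zB i : (Num.truncn (u i) < 2 * B)%N.
  by have /andP[u0 u1] := uB i; rewrite truncn_lt_nat.
exists [ffun i => Ordinal (zB i)]; rewrite /eucl_dist.
apply: eucl_norm_le => [|i]; first exact: ltW.
rewrite !mxE ffunE/=; have /andP[u0 _] := uB i.
have /andP[z1 z2] := truncn_itv u0; move: (Num.truncn (u i)) z1 z2 => k z1 z2.
rewrite (_ : _ - _ = h * (u i - k%:R)); last by rewrite /u; field; rewrite gt_eqF.
rewrite normrM gtr0_norm// ger_pMr// ger0_norm ?subr_ge0//.
by rewrite lerBlDl natr1 ltW.
Qed.

End Lattice.

Section Process.
Context {R : realType} {d : nat} {dO : measure_display} {Omega : measurableType dO}.
Variables (P : 'rV[R]_d -> probability Omega R) (X : R -> Omega -> 'rV[R]_d).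
Variable F : R -> set (set Omega).
Hypothesis hMarkov : markov_process P X F.

Lemma filtration_sigma t : 0 <= t -> sigma_algebra setT (F t).
Proof. by case: hMarkov => -[] + _ _ _ _ _ _; exact. Qed.

Lemma filtration_measurable t : 0 <= t -> F t `<=` measurable.
Proof. by case: hMarkov => -[] _ + _ _ _ _ _; exact. Qed.

Lemma filtration_le s t : 0 <= s -> s <= t -> F s `<=` F t.
Proof. by case: hMarkov => -[] _ _ + _ _ _ _; exact. Qed.

Lemma filtration_adapted t B : 0 <= t -> borel B -> F t (X t @^-1` B).
Proof. by case: hMarkov => _ + _ _ _; exact. Qed.

Lemma markov_le x s t A B (c : R) : 0 <= s -> 0 <= t -> F s A -> borel B ->
  (forall w, A w -> (transition P X t (X s w) B <= c%:E)%E) ->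
  (P x (A `&` X (s + t) @^-1` B) <= c%:E * P x A)%E.
Proof.
move=> s0 t0 FA bB Ac; case: (hMarkov) => _ _ _ mk mkv.
have mA : measurable A by exact: filtration_measurable FA.
rewrite mkv// -integral_cst//; apply: ge0_le_integral => //.
- apply: (@measurable_funS _ _ _ _ setT) => //.
  apply: (@measurableT_comp _ _ _ Omega (g_sigma_algebraType (@open 'rV[R]_d)) (\bar R)
    (fun x => transition P X t x B) setT (X s)).
    exact: mk.
  move=> _ Y mY; rewrite setTI; apply: (filtration_measurable s0).
  exact: filtration_adapted.
Qed.

Variable H : R.
Hypotheses (hH : 0 < H) (hSS : self_similar P X H).

Lemma transition_ballC t z a : 0 < t -> transition P X t z (~` eucl_ball z a) =
  transition P X 1 (t^-1 `^ H *: z) (~` eucl_ball (t^-1 `^ H *: z) (t^-1 `^ H * a)).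
Proof.
move=> t0; have ti0 : 0 < t^-1 by rewrite invr_gt0.
rewrite (hSS z t0 ti0); last exact: borel_eucl_ballC.
by rewrite mulVf ?gt_eqF// scale_eucl_ballC// powR_gt0.
Qed.

Lemma transition_ball t z y a : 0 < t -> transition P X t z (eucl_ball y a) =
  transition P X 1 (t^-1 `^ H *: z) (eucl_ball (t^-1 `^ H *: y) (t^-1 `^ H * a)).
Proof.
move=> t0; have ti0 : 0 < t^-1 by rewrite invr_gt0.
rewrite (hSS z t0 ti0); last exact: borel_eucl_ball.
by rewrite mulVf ?gt_eqF// scale_eucl_ball// powR_gt0.
Qed.

Lemma transition0_ballC z a : 0 < a -> transition P X 0 z (~` eucl_ball z a) = 0%E.
Proof.
move=> a0; have mX B : borel B -> measurable (X 0 @^-1` B).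
  by move=> bB; apply: (filtration_measurable (lexx 0)); exact: filtration_adapted.
have hst : P z (X 0 @^-1` eucl_ball z a) = 1%E.
  apply/eqP; rewrite eq_le probability_le1; last by apply: mX; exact: borel_eucl_ball.
  have <- : P z (X 0 @^-1` [set z]) = 1%E by case: hMarkov.
  apply: le_measure; rewrite ?inE.
  - have -> : X 0 @^-1` [set z] = \bigcap_n X 0 @^-1` eucl_ball z n.+1%:R^-1.
      apply/seteqP; split=> [w /= wz n _|w /= wz]; first by rewrite /eucl_ball/= wz eucl_distxx.
      apply/eqP; rewrite -subr_eq0; apply/eqP/eucl_norm_eq0/eqP.
      rewrite eq_le eucl_norm_ge0 andbT; apply/ler_addgt0Pl => e e0.
      rewrite addr0 (le_trans (ltW (wz (Num.truncn e^-1) I)))// invf_ple ?posrE//.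
      exact/ltW/truncnS_gt.
    by apply: bigcapT_measurable => n; apply: mX; exact: borel_eucl_ball.
  - by apply: mX; exact: borel_eucl_ball.
  - by move=> w /= wz; rewrite /eucl_ball/= wz eucl_distxx.
rewrite /transition preimage_setC probability_setC ?hst ?subee//.
exact: (mX _ (borel_eucl_ball z a)).
Qed.

Lemma tail_le : tail_condition P X -> exists beta C a1 : R,
  [/\ 0 < beta, 0 < C, 0 < a1 & forall (tau t a : R) z, 0 < tau -> 0 <= t <= tau ->
    a1 < tau^-1 `^ H * a ->
    (transition P X t z (~` eucl_ball z a) <= (C * (tau^-1 `^ H * a) `^ (- beta))%:E)%E].
Proof.
move=> [beta [C [a1 [b0 C0 a10 tail]]]]; exists beta, C, a1; split=> // tau t a z tau0.
have ti0 : 0 < tau^-1 `^ H by rewrite powR_gt0// invr_gt0.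
move=> /andP[t0 tt] a1a.
have a0 : 0 < a by rewrite -(pmulr_rgt0 _ ti0) (lt_trans a10).
move: t0; rewrite le_eqVlt => /predU1P[<-|t0].
  by rewrite transition0_ballC// lee_fin mulr_ge0 ?powR_ge0// ltW.
have tle : tau^-1 `^ H * a <= t^-1 `^ H * a.
  rewrite ler_pM2r//; apply: ge0_ler_powR; first exact: ltW.
  - by rewrite nnegrE invr_ge0 ltW.
  - by rewrite nnegrE invr_ge0 ltW.
  by rewrite lef_pV2.
rewrite transition_ballC// (le_trans (tail _ _ _)) ?(lt_le_trans a1a)//.
rewrite lee_fin ler_pM2l// !powRN lef_pV2 ?posrE ?powR_gt0//.
- by apply: ge0_ler_powR; rewrite ?nnegrE ?(ltW b0)// mulr_ge0 ?powR_ge0// ltW.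
- by rewrite mulr_gt0// powR_gt0// invr_gt0.
- by rewrite mulr_gt0.
Qed.

Lemma increment_le x s t (a p : R) A : 0 <= s -> 0 <= t -> 0 < a -> 0 <= p -> F s A ->
  (forall z, (transition P X t z (~` eucl_ball z a) <= p%:E)%E) ->
  (P x (A `&` [set w | (2 * a <= eucl_dist (X (s + t) w) (X s w))%R]) <= p%:E * P x A)%E.
Proof.
move=> s0 t0 a0 p0 FA tp.
(* The Markov property only sees fixed Borel sets, whereas the reference [X s] is
   random: localize it to countably many small balls. *)
pose h := a / (2 * d.+1%:R).
have h0 : 0 < h by rewrite divr_gt0// mulr_gt0.
have dh : d%:R * h < a / 2.
  rewrite /h (_ : _ * _ = a / 2 * (d%:R / d.+1%:R)).
    by rewrite gtr_pMr ?divr_gt0// ltr_pdivrMr// mul1r ltr_nat.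
  by field; rewrite ?gt_eqF// ltr0n.
pose c j : 'rV[R]_d := if @unpickle (nat * {ffun 'I_d -> nat})%type j is Some (B, z)
  then lattice_point h B z else 0.
have c_dense v : exists j, eucl_dist v (c j) < a / 2.
  pose B := (Num.truncn (eucl_norm v / h)).+1.
  have [i|z hz] := @lattice_approx _ _ v h B h0.
    rewrite (le_lt_trans (coord_le_eucl_norm _ _))// mulrC -ltr_pdivrMr//.
    exact: truncnS_gt.
  exists (pickle (B, [ffun i => z i : nat])); rewrite /c pickleK.
  apply: le_lt_trans dh; apply: le_trans hz.
  rewrite le_eqVlt; apply/orP; left; apply/eqP; congr eucl_dist.
  by apply/rowP => i; rewrite !mxE ffunE.
pose V j := A `&` [set w | eucl_dist (X s w) (c j) < a / 2].
have sF := filtration_sigma s0.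
have st0 : 0 <= s + t by rewrite addr_ge0.
have FV j : F s (V j).
  apply: (sigmaI sF) => //.
  exact: (filtration_adapted s0 (borel_eucl_ball (c j) (a / 2))).
pose W := [set w | 2 * a <= eucl_dist (X (s + t) w) (X s w)].
have mW : measurable W.
  apply: (filtration_measurable st0).
  rewrite /W set_le_setC; apply: (sigmaC (filtration_sigma st0)).
  apply: (sigma_eucl_dist (filtration_sigma st0)) => B bB; first exact: filtration_adapted.
  by apply: (filtration_le s0 _ (filtration_adapted s0 bB)); rewrite lerDl.
have VA : \bigcup_j V j = A.
  apply/seteqP; split=> [w [j _ []]//|w Aw]; have [j cj] := c_dense (X s w).
  by exists j.
rewrite -/W -{2}VA.
apply: (@le_trans _ _ (P x (\bigcup_j (seqDU V j `&` W)))).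
  apply: le_measure; rewrite ?inE.
  - by apply: measurableI => //; exact: filtration_measurable FA.
  - apply: bigcup_measurable => j _; apply: measurableI => //.
    apply: (filtration_measurable s0); apply: (sigmaD sF) => //.
    exact: (sigma_bigsetU sF).
  - by rewrite -setI_bigcupl -seqDU_bigcup_eq VA.
apply: (@first_passage_le _ _ _ (P x) (fun=> F s) _ _ _ V (fun=> W)) => //.
- by move=> _; exact: filtration_measurable.
- by move=> *.
- move=> j B FB BV.
  (* The localization costs [a / 2] twice: a move of [2 * a] from [X s] leaves the ball of radius
     [3 * a / 2] about [c j], and this ball contains the ball of radius [a] about [X s]. *)
  apply: (@le_trans _ _ (P x (B `&` X (s + t) @^-1` (~` eucl_ball (c j) (a + a / 2))))).
    apply: le_measure; rewrite ?inE.
    + by apply: measurableI => //; exact: filtration_measurable FB.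
    + apply: measurableI; first exact: filtration_measurable FB.
      apply: (filtration_measurable st0); apply: filtration_adapted => //.
      exact: borel_eucl_ballC.
    + move=> w [Bw Ww]; split=> //= wc; have [_ /= wj] := BV w Bw.
      have := eucl_dist_tri (X (s + t) w) (c j) (X s w).
      by move: Ww wc; rewrite /W /eucl_ball/= (eucl_distC (c j)); lra.
  apply: markov_le => //; first exact: borel_eucl_ballC.
  move=> w Bw; apply: le_trans (tp (X s w)); rewrite /transition.
  have mX B' : borel B' -> measurable (X t @^-1` B').
    by move=> bB; apply: (filtration_measurable t0); exact: filtration_adapted.
  apply: le_measure; rewrite ?inE; try by apply: mX; exact: borel_eucl_ballC.
  apply: preimage_subset => v; apply: contra_not; rewrite /eucl_ball/= => va.
  have := eucl_dist_tri v (X s w) (c j); have [_ /=] := BV w Bw; lra.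
Qed.

End Process.

(** * Almost sure covering properties of the path *)

Section LiminfEvents.
Context {R : realType} {dO : measure_display} {Omega : measurableType dO}.
Variable mu : probability Omega R.

(* Path events on the grids of mesh [2^-m] that increase with [m], contained in
   measurable events [E m], have their union in [liminf_event E]; their own
   measurability is not needed. *)
Definition liminf_event (E : nat -> set Omega) : set Omega :=
  \bigcup_m \bigcap_(k in [set k | (m <= k)%N]) E k.

Lemma liminf_eventP E w : liminf_event E w <->
  exists m, forall k, (m <= k)%N -> E k w.
Proof. by split=> [[m _ h]|[m h]]; [exists m|exists m]. Qed.

Lemma measurable_liminf_event E : (forall m, measurable (E m)) ->
  measurable (liminf_event E).
Proof.
move=> mE; apply: bigcup_measurable => m _; apply: bigcap_measurable => //.
by exists m => /=.
Qed.

(** The tail intersections increase to the liminf event and are contained in the [E m]: continuity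
    from below. *)
Lemma liminf_event_le (E : nat -> set Omega) (m0 : nat) (B : \bar R) :
  (forall m, measurable (E m)) -> (forall m, (m0 <= m)%N -> (mu (E m) <= B)%E) ->
  (mu (liminf_event E) <= B)%E.
Proof.
move=> mE EB; rewrite /liminf_event.
set G := fun m => \bigcap_(k in [set k | (m <= k)%N]) E k.
have mG m : measurable (G m) by apply: bigcap_measurable => //; exists m => /=.
have ndG : nondecreasing_seq G.
  move=> i j ij; apply/subsetPset => w Gi k /= jk; apply: Gi => /=.
  exact: leq_trans jk.
have cG := @nondecreasing_cvg_mu _ _ _ mu G mG (bigcupT_measurable G mG) ndG.
rewrite -(cvg_lim _ cG)//; apply: lime_le; first by apply/cvg_ex; eexists; exact: cG.
near=> m; have mm : (m0 <= m)%N by near: m; exists m0.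
apply: le_trans (EB _ mm); apply: le_measure; rewrite ?inE//.
by move=> w; apply => /=.
Unshelve. all: by end_near.
Qed.

Lemma borel_cantelli (E : nat -> set Omega) (n1 : nat) :
  (forall n, measurable (E n)) ->
  (forall n, (n1 <= n)%N -> (mu (E n) <= (2 ^- n.+1)%:E)%E) ->
  {ae mu, forall w, exists n0, forall n, (n0 <= n)%N -> ~ E n w}.
Proof.
move=> mE En; pose G n := E (n1 + n)%N.
have G0 : mu (lim_sup_set G) = 0%E.
  apply: lim_sup_set_cvg0 => [k|]; first exact: mE.
  apply: (@le_lt_trans _ _ 1%:E); last exact: ltry.
  apply: (le_trans _ (@epsilon_trick0 R 1 xpredT ler01)); apply: lee_nneseries => // n _.
  apply: (le_trans (En _ (leq_addr _ _))); rewrite lee_fin mul1r natrX lef_pV2 ?posrE ?exprn_gt0//.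
  by rewrite ler_eXn2l ?ltr1n// ltnS leq_addl.
exists (lim_sup_set G); split=> //.
  apply: bigcap_measurable => // n _; apply: bigcup_measurable => k _; exact: mE.
move=> w /= nw n _; apply: contrapT => h; apply: nw.
exists (n1 + n)%N => k nk Ek; apply: h; exists (k - n1)%N => /=.
  by rewrite leq_subRL// (leq_trans (leq_addr _ _) nk).
by rewrite /G subnKC// (leq_trans (leq_addr _ _) nk).
Qed.

End LiminfEvents.

(** * Dyadic grids and approximation from the right *)

Section Dyadic.
Context {R : realType}.
Implicit Types (t : R) (m n k : nat).

Definition dyadic m k : R := k%:R / 2 ^+ m.

(** Strictly after [t] even when [t] is on the grid, because the filter [t^'+] excludes [t]
    itself. *)
Definition dyadic_above m t : nat := (Num.truncn (t * 2 ^+ m)).+1.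

Lemma dyadic_ge0 m k : 0 <= dyadic m k.
Proof. by rewrite divr_ge0// exprn_ge0. Qed.

Lemma dyadic_le m j k : (j <= k)%N -> dyadic m j <= dyadic m k.
Proof. by move=> jk; rewrite ler_pM2r ?invr_gt0 ?exprn_gt0// ler_nat. Qed.

Lemma dyadicB m j k : (j <= k)%N -> dyadic m k = dyadic m j + dyadic m (k - j).
Proof. by move=> jk; rewrite /dyadic -mulrDl -natrD subnKC. Qed.

Lemma dyadic_refine n m k : (n <= m)%N -> dyadic m (k * 2 ^ (m - n)) = dyadic n k.
Proof.
move=> nm; rewrite /dyadic natrM natrX -[in X in _ / X](subnK nm) exprD.
by rewrite invfM mulrA mulfK// expf_neq0.
Qed.

Lemma dyadic_above_gt m t : 0 <= t -> t < dyadic m (dyadic_above m t).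
Proof.
by move=> t0; rewrite /dyadic ltr_pdivlMr ?exprn_gt0// truncnS_gt.
Qed.

Lemma dyadic_above_le m t : 0 <= t -> dyadic m (dyadic_above m t) <= t + 2 ^- m.
Proof.
move=> t0; rewrite /dyadic ler_pdivrMr ?exprn_gt0// mulrDl mulVf ?expf_neq0//.
rewrite /dyadic_above -natr1 lerD2r truncn_le mulr_ge0// exprn_ge0//.
Qed.

Lemma le_dyadic_above m t t' : t <= t' -> (dyadic_above m t <= dyadic_above m t')%N.
Proof. by move=> tt'; rewrite ltnS le_truncn// ler_wpM2r// exprn_ge0. Qed.

Lemma dyadic_above_block n m k t : (n <= m)%N -> dyadic n k <= t < dyadic n k.+1 ->
  (k * 2 ^ (m - n) <= Num.truncn (t * 2 ^+ m) < k.+1 * 2 ^ (m - n))%N.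
Proof.
move=> nm; rewrite -!(dyadic_refine _ nm) /dyadic => /andP[].
rewrite ler_pdivrMr ?exprn_gt0// ltr_pdivlMr ?exprn_gt0// => kt tk.
have t0 : 0 <= t * 2 ^+ m by apply: le_trans kt.
by rewrite truncn_ge_nat// truncn_lt_nat// kt.
Qed.

Lemma dyadic_block n t : 0 <= t ->
  dyadic n (Num.truncn (t * 2 ^+ n)) <= t < dyadic n (Num.truncn (t * 2 ^+ n)).+1.
Proof.
move=> t0; rewrite dyadic_above_gt// /dyadic ler_pdivrMr ?exprn_gt0// truncn_le.
by rewrite mulr_ge0// exprn_ge0.
Qed.

Lemma dyadic_above_right (d : nat) (f : R -> 'rV[R]_d) t (e : R) : 0 <= t ->
  f s @[s --> t^'+] --> f t -> 0 < e ->
  exists m0, forall m, (m0 <= m)%N ->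
    eucl_dist (f (dyadic m (dyadic_above m t))) (f t) < e.
Proof.
move=> t0 ft e0.
have : nbhs (f t) (eucl_ball (f t) e).
  by apply: open_nbhs_nbhs; split; [exact: open_eucl_ball|rewrite /eucl_ball/= eucl_distxx].
move=> /ft[eta /= eta0 heta].
have [m0 hm0] := pow2N_small (@ltr01 R) (divr_gt0 eta0 (ltr0n R 2)).
exists m0 => m /hm0; rewrite mul1r => hm.
apply: heta; last exact: dyadic_above_gt.
rewrite /ball_/= ler0_norm ?subr_le0; last exact/ltW/dyadic_above_gt.
rewrite opprB ltrBlDl (le_lt_trans (dyadic_above_le m t0))// ltrD2l.
rewrite -powR_mulrn// -powRN (le_lt_trans hm)//; move: eta0; lra.
Qed.

End Dyadic.

Lemma pow2_linear {R : realType} (K c : R) : 0 < c ->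
  exists n0, forall n, (n0 <= n)%N -> K * n%:R <= 2 `^ (c * n%:R).
Proof.
move=> c0; have c20 : 0 < c / 2 by rewrite divr_gt0.
have [n1 h1] := @pow2_absorb R _ (`|K| * (2 / c)) c20.
exists n1 => n n1n.
have n_le : c / 2 * n%:R <= 2 `^ (c / 2 * n%:R).
  have cn0 : 0 <= c / 2 * n%:R by rewrite mulr_ge0// ltW.
  have /andP[_ /ltW h] := truncn_itv cn0; apply: (le_trans h).
  rewrite (@le_trans _ _ (2 `^ (Num.truncn (c / 2 * n%:R))%:R))//.
    by rewrite pow2_nat -natrX ler_nat ltn_expl.
  by rewrite le_pow2// truncn_le.
have -> : c * n%:R = c / 2 * n%:R + c / 2 * n%:R by field.
rewrite pow2D.
have -> : K * n%:R = (K * (2 / c)) * (c / 2 * n%:R) by field; rewrite gt_eqF.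
have le1 : K * (2 / c) <= 2 `^ (c / 2 * n%:R).
  apply: le_trans (h1 _ n1n); rewrite ler_wpM2r ?ler_norm// divr_ge0// ltW//.
apply: (@le_trans _ _ (2 `^ (c / 2 * n%:R) * (c / 2 * n%:R))).
  by rewrite ler_wpM2r// mulr_ge0// ltW.
by rewrite ler_wpM2l// powR_ge0.
Qed.

Lemma union_bound {R : realType} {dO : measure_display} {Omega : measurableType dO}
    (mu : probability Omega R) (I : finType) (E : I -> set Omega) (B : R) :
  (forall i, measurable (E i)) -> (forall i, (mu (E i) <= B%:E)%E) ->
  (mu (\bigcup_(i in [set: I]) E i) <= (#|I|%:R * B)%:E)%E.
Proof.
move=> mE EB; 
pose F k := if insub k is Some k' then E (enum_val (k' : 'I_#|I|)) else set0.
have FE (k : 'I_#|I|) : F k = E (enum_val k).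
  by rewrite /F insubT ?ltn_ord//= => ?; congr E; congr enum_val; exact: val_inj.
have mF k : measurable (F k) by rewrite /F; case: insubP.
have mU : measurable (\bigcup_(i in [set: I]) E i).
  by apply: fin_bigcup_measurable => // i _.
apply: (@le_trans _ _ (\sum_(k < #|I|) mu (F k))%E).
  apply: (content_subadditive mu) => //.
  move=> w [i _ Ei]; rewrite -bigcup_mkord; exists (enum_rank i) => //=.
  by rewrite FE enum_rankK.
apply: (@le_trans _ _ (\sum_(k < #|I|) B%:E)%E).
  by apply: lee_sum => k _; rewrite FE.
by rewrite sumEFin sumr_const card_ord mulr_natl.
Qed.

(** Each range from [2 ^ n] to [2 ^ n.+1] contributes at most 1. *)
Lemma harmonic_le {R : realFieldType} (n : nat) :
  \sum_(1 <= i < 2 ^ n) i%:R^-1 <= n%:R :> R.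
Proof.
elim: n => [|n IHn]; first by rewrite big_geq.
have n12 : (2 ^ n <= 2 ^ n.+1)%N by rewrite leq_exp2l.
rewrite (big_cat_nat (n := 2 ^ n)) ?expn_gt0//= -natr1 lerD//.
apply: (@le_trans _ _ (\sum_(2 ^ n <= i < 2 ^ n.+1) (2 ^ n)%:R^-1)).
  rewrite big_nat [leRHS]big_nat; apply: ler_sum => i /andP[ni _].
  by rewrite lef_pV2 ?posrE ?ltr0n ?ler_nat ?expn_gt0// (leq_trans _ ni)// expn_gt0.
rewrite big_const_nat iter_addr_0 expnS mul2n -addnn addnK -[leLHS]mulr_natr mulVf//.
Qed.

(** * From grid estimates to almost sure properties of the path *)

Section PathProperties.
Context {R : realType} {d : nat} {dO : measure_display} {Omega : measurableType dO}.
Variables (P : 'rV[R]_d -> probability Omega R) (X : R -> Omega -> 'rV[R]_d).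
Variable F : R -> set (set Omega).
Hypothesis hMarkov : markov_process P X F.
Variable H : R.
Hypotheses (hH : 0 < H) (hSS : self_similar P X H).

Let grid m j := X (dyadic m j).
Let gridF m j := F (dyadic m j).

Let sG m j : sigma_algebra setT (gridF m j).
Proof. exact: (filtration_sigma hMarkov (dyadic_ge0 m j)). Qed.

Let Gm m j : gridF m j `<=` measurable.
Proof. exact: (filtration_measurable hMarkov (dyadic_ge0 m j)). Qed.

Let Gle m i j : (i <= j)%N -> gridF m i `<=` gridF m j.
Proof.
by move=> ij; apply: (filtration_le hMarkov (dyadic_ge0 m i)); exact: dyadic_le.
Qed.

Let GY m j B : borel B -> gridF m j (grid m j @^-1` B).
Proof. exact: (filtration_adapted hMarkov (dyadic_ge0 m j)). Qed.

(** The grid indices run over the [k]-th interval of length [2 ^- n]. For [m < n] the truncated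
    subtraction gives another range, without effect on a liminf in [m]. *)
Definition escape_event n a K (k : nat) : set Omega :=
  liminf_event (fun m => escapes (grid m) (k.+1 * 2 ^ (m - n)) a K (k * 2 ^ (m - n))).

Lemma measurable_escape_event n a K k : measurable (escape_event n a K k).
Proof.
apply: measurable_liminf_event => m.
exact: (measurable_escapes (sG m) (@Gm m) (@Gle m) (@GY m)).
Qed.

Lemma escape_event_le x n a p K k : 0 < a -> 0 <= p -> p <= 2^-1 ->
  (forall t z, 0 <= t <= 2 ^- n -> (transition P X t z (~` eucl_ball z a) <= p%:E)%E) ->
  (P x (escape_event n a K k) <= ((2 * p) ^+ K)%:E)%E.
Proof.
move=> a0 p0 p2 tp; apply: (@liminf_event_le _ _ _ _ _ n) => [m|m nm].
  exact: (measurable_escapes (sG m) (@Gm m) (@Gle m) (@GY m)).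
rewrite -[X in P x X]setTI -[leRHS]mule1 -(@probability_setT _ _ _ (P x)).
apply: (escapes_le (sG m) (@Gm m) (@Gle m) (@GY m) p0 p2 (n0 := (k * 2 ^ (m - n))%N)) => //.
- move=> i j B ki ij jk GB; rewrite /grid (dyadicB m ij).
  apply: (increment_le hMarkov) => //; try exact: dyadic_ge0.
  move=> z; apply: tp; rewrite dyadic_ge0/= -[2 ^- n]mul1r -[1]/(1%:R).
  rewrite -/(dyadic n 1) -(dyadic_refine _ nm) dyadic_le// mul1n.
  by rewrite leq_subLR (leq_trans jk)// mulSn addnC leq_add2r.
- by rewrite leq_mul2r leqnSn orbT.
- exact: (sigmaT (sG m _)).
Qed.

(** If all [K] jumps exceeded [8 * a], each would do so by a positive gap; by right continuity the
    grid points just after the times [T l] would keep jumps of at least [8 * a] on every fine grid,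
    and [chain_escapes] would apply. *)
Lemma escape_path n a K k w (T : nat -> R) : 0 < a ->
  (forall t, 0 <= t -> X s w @[s --> t^'+] --> X t w) ->
  ~ escape_event n a K k w ->
  (forall l, (l <= K)%N -> dyadic n k <= T l < dyadic n k.+1) ->
  (forall l, (l < K)%N -> T l <= T l.+1) ->
  exists2 l, (l < K)%N & eucl_dist (X (T l.+1) w) (X (T l) w) <= 8 * a.
Proof.
move=> a0 rc nE Tk Tmon; apply/not_exists2P => Tfar; apply: nE.
have T0 l : (l <= K)%N -> 0 <= T l.
  by move=> /Tk /andP[+ _]; apply: le_trans; exact: dyadic_ge0.
pose gap l := eucl_dist (X (T l.+1) w) (X (T l) w) - 8 * a.
have gap0 l : (l < K)%N -> 0 < gap l.
  by move=> lK; have [/(_ lK)//|/negP] := Tfar l; rewrite -ltNge subr_gt0.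
have h l : exists m0, forall m, (m0 <= m)%N -> (l < K)%N ->
    8 * a <= eucl_dist (X (dyadic m (dyadic_above m (T l.+1))) w)
                       (X (dyadic m (dyadic_above m (T l))) w).
  have [lK|lK] := ltnP l K; last by exists 0%N.
  have g0 : 0 < gap l / 2 by rewrite divr_gt0// gap0.
  have [m1 h1] := dyadic_above_right (T0 l.+1 lK) (rc _ (T0 _ lK)) g0.
  have [m2 h2] := dyadic_above_right (T0 l (ltnW lK)) (rc _ (T0 _ (ltnW lK))) g0.
  exists (maxn m1 m2) => m; rewrite geq_max => /andP[/h1 {}h1 /h2 {}h2] _.
  move: h1 h2; set u := X (dyadic _ _) w; set v := X (dyadic _ _) w => h1 h2.
  have := eucl_dist_tri (X (T l.+1) w) u (X (T l) w).
  have := eucl_dist_tri u v (X (T l) w).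
  by move: h1 h2; rewrite (eucl_distC (X (T l.+1) w) u) /gap; lra.
have [M hM] := choice h.
apply/liminf_eventP; exists (maxn n (\max_(l < K) M l)) => m; rewrite geq_max => /andP[nm Mm].
apply: (chain_escapes a0 (c := fun l => dyadic_above m (T l))).
- by have /andP[+ _] := dyadic_above_block nm (Tk 0%N (leq0n _)); move/leqW.
- by have /andP[_] := dyadic_above_block nm (Tk K (leqnn _)).
- by move=> l lK; apply/le_dyadic_above/Tmon.
- move=> l lK; apply: hM => //; apply: leq_trans Mm.
  exact: (leq_bigmax (Ordinal lK)).
Qed.

Hypothesis hB1 : tail_condition P X.

Lemma increments_ae x gamma : 0 < gamma < H ->
  {ae P x, forall w, exists K n0, forall n, (n0 <= n)%N -> forall k, (k < 4 ^ n)%N ->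
    ~ escape_event n (2 `^ (- (gamma * n%:R)) / 8) K k w}.
Proof.
move=> /andP[g0 gH].
have [beta [C [a1 [b0 C0 a10 tail]]]] := tail_le hMarkov hH hSS hB1.
pose kappa := (H - gamma) * beta.
have Hg0 : 0 < H - gamma by rewrite subr_gt0.
have kappa0 : 0 < kappa by rewrite mulr_gt0.
pose p n := C * (2 `^ ((H - gamma) * n%:R) / 8) `^ (- beta).
have p0 n : 0 <= p n by rewrite mulr_ge0 ?powR_ge0// ltW.
pose a n : R := 2 `^ (- (gamma * n%:R)) / 8.
have a0 n : 0 < a n by rewrite divr_gt0 ?pow2_gt0.
have [n1 h1] := @pow2_absorb R _ (8 * (a1 + 1)) Hg0.
pose K0 := 2 * C * 8 `^ beta.
have k20 : 0 < kappa / 2 by rewrite divr_gt0.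
have [n2 h2] := @pow2_absorb R _ (K0 + 1) k20.
have half0 : 0 < 2^-1 :> R by rewrite invr_gt0.
have [n3 h3] := pow2N_small k20 half0.
have pE n : 2 * p n = K0 * 2 `^ (- (kappa * n%:R)).
  rewrite /p /K0 powRM ?powR_ge0// -powRrM -powR_inv1// -powRrM.
  rewrite (_ : -1 * - beta = beta); last by ring.
  rewrite (_ : (H - gamma) * n%:R * - beta = - (kappa * n%:R)); last by rewrite /kappa; ring.
  by ring.
have p_small n : (n2 <= n)%N -> 2 * p n <= 2 `^ (- (kappa / 2 * n%:R)).
  move=> /h2 hn; rewrite pE (_ : kappa * n%:R = kappa / 2 * n%:R + kappa / 2 * n%:R); last by field.
  rewrite opprD pow2D mulrA -[leRHS]mul1r ler_pM2r ?pow2_gt0//.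
  rewrite powRN ler_pdivrMr ?pow2_gt0// mul1r (le_trans _ hn)// lerDl//.
have tp n t z : (n1 <= n)%N -> 0 <= t <= 2 ^- n ->
    (transition P X t z (~` eucl_ball z (a n)) <= (p n)%:E)%E.
  move=> /h1 hn tn; have e : ((2 ^- n)^-1 `^ H * a n) = 2 `^ ((H - gamma) * n%:R) / 8.
    rewrite invrK -powR_mulrn// -powRrM /a mulrA -pow2D; congr (2 `^ _ / _); ring.
  rewrite /p -e; apply: tail => //.
  by rewrite e; move: hn; lra.
(* The [4 ^ n] intervals and the target [2 ^- n.+1] require [kappa / 2 * K * n] to be at least
   [3 * n + 1]; this [K] gives more than [4 * n]. *)
pose K := (Num.truncn (4 / (kappa / 2) + 1)).+1.
have K3 : 4 / (kappa / 2) + 1 <= K%:R by rewrite ltW// truncnS_gt.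
pose E n := \bigcup_(k in [set: 'I_(4 ^ n)]) escape_event n (a n) K k.
have mE n : measurable (E n).
  by apply: fin_bigcup_measurable => // k _; exact: measurable_escape_event.
have ae := @borel_cantelli _ _ _ (P x) E (maxn 1%N (maxn n1 (maxn n2 n3))) mE.
apply: filterS (ae _).
  move=> w [n0 hn0]; exists K, n0 => n /hn0 nE k kn Ek; apply: nE.
  by exists (Ordinal kn).
move=> n; rewrite !geq_max => /and4P[n_gt0 n1n n2n n3n].
apply: (@le_trans _ _ (#|'I_(4 ^ n)|%:R * (2 * p n) ^+ K)%:E).
  apply: union_bound => k; first exact: measurable_escape_event.
  apply: escape_event_le => //.
    have := le_trans (p_small _ n2n) (h3 _ n3n); lra.
  by move=> t z; exact: tp.
rewrite lee_fin card_ord.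
have -> : (4 ^ n)%:R = 2 `^ (2 * n%:R) :> R.
  have e : (4 ^ n = 2 ^ (2 * n))%N by rewrite expnM.
  by rewrite e natrX -pow2_nat natrM.
have pK : (2 * p n) ^+ K <= 2 `^ (- (kappa / 2 * n%:R) * K%:R).
  rewrite powRrM powR_mulrn ?powR_ge0//.
  apply: lerXn2r; rewrite ?nnegrE ?powR_ge0 ?(mulr_ge0 _ (p0 n))//.
  exact: p_small.
apply: (le_trans (ler_wpM2l (powR_ge0 _ _) pK)); rewrite -pow2D -powR_mulrn// -powRN.
apply: le_pow2.
have kK : 4 + kappa / 2 <= kappa / 2 * K%:R.
  have := ler_wpM2l (ltW k20) K3; rewrite mulrDr mulr1 mulrCA divff ?mulr1 ?gt_eqF//.
have n1' : 1 <= n%:R :> R by rewrite ler1n.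
have : (4 + kappa / 2) * n%:R <= kappa / 2 * K%:R * n%:R by rewrite ler_wpM2r.
have : 0 <= kappa / 2 * n%:R by rewrite mulr_ge0// ltW.
rewrite (_ : - (kappa / 2 * n%:R) * K%:R = - (kappa / 2 * K%:R * n%:R)); last by ring.
rewrite -natr1 mulrDl; move: (kappa / 2 * n%:R) (kappa / 2 * K%:R * n%:R) => u v.
lra.
Qed.

Definition hit_event n q r (y : 'rV[R]_d) : set Omega :=
  liminf_event (fun m => [set w | (q < hits (grid m) y r (2 ^ (m - n)) 0 (4 ^ n) w)%N]).

Let measurable_grid_hits n q r y m :
  measurable [set w | (q < hits (grid m) y r (2 ^ (m - n)) 0 (4 ^ n) w)%N].
Proof.
apply: (measurable_hits (sG m) (@Gm m) (@Gle m) (@GY m) _ _ _ (fun x => (q < x)%N)).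
by rewrite expn_gt0.
Qed.

Lemma measurable_hit_event n q r y : measurable (hit_event n q r y).
Proof. by apply: measurable_liminf_event => m; exact: measurable_grid_hits. Qed.

Lemma hit_event_le x n y r (c : nat -> R) Q M p : 0 < r -> (0 < Q)%N -> 0 <= M ->
  (forall t z, 0 <= t <= 2 ^- n -> (transition P X t z (~` eucl_ball z r) <= (2^-1)%:E)%E) ->
  (forall k t z, (0 < k)%N -> dyadic n k <= t -> eucl_dist z y < r ->
    (transition P X t z (eucl_ball y (2 * r)) <= (c k)%:E)%E) ->
  (forall k, (k < 4 ^ n)%N -> \sum_(k.+1 <= l < 4 ^ n) 2 * c (l - k)%N <= M) ->
  (P x (hit_event n (p * Q) r y) <= ((M / Q%:R) ^+ p)%:E)%E.
Proof.
move=> r0 Q0 M0 tstay tret cM.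
apply: (@liminf_event_le _ _ _ _ _ n) => [m|m nm]; first exact: measurable_grid_hits.
have b0 : (0 < 2 ^ (m - n))%N by rewrite expn_gt0.
have bE k : dyadic m (k * 2 ^ (m - n)) = dyadic n k :> R by exact: dyadic_refine.
have mG i j B B' : gridF m i B -> borel B' -> measurable (B `&` grid m j @^-1` B').
  by move=> GB bB; apply: measurableI; [exact: Gm GB|exact: Gm (GY m j bB)].
have mX t B : 0 <= t -> borel B -> measurable (X t @^-1` B).
  by move=> t0 bB; apply: (filtration_measurable hMarkov t0); exact: (filtration_adapted hMarkov).
apply: (total_hits_le (sG m) (@Gm m) (@Gle m) (@GY m) b0 (c := c)) => //.
- move=> j B jN GB By; have jlt := ltn_ceil j b0.
  rewrite {1}/grid (dyadicB m (ltnW jlt)).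
  set u := dyadic m (_ - j).
  rewrite set_le_setC -[~` _]/(X (dyadic m j + u) @^-1` (~` eucl_ball y (2 * r))).
  apply: (markov_le hMarkov) => //; try exact: dyadic_ge0; first exact: borel_eucl_ballC.
  move=> w Bw; apply: le_trans (tstay u (X (dyadic m j) w) _).
    apply: le_measure; rewrite ?inE; try (apply: mX; [exact: dyadic_ge0|exact: borel_eucl_ballC]).
    apply: preimage_subset => v; apply: contra_not; rewrite /eucl_ball/= => va.
    by have := eucl_dist_tri v (X (dyadic m j) w) y; have /= := By w Bw; rewrite /grid; lra.
  rewrite dyadic_ge0/= -[2 ^- n]mul1r -[1]/(1%:R) -/(dyadic n 1) -bE dyadic_le// mul1n.
  by rewrite leq_subLR mulSn addnC leq_add2r leq_divM.
- move=> j k B /andP[jk kN] GB By.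
  have jlt : (j <= k.+1 * 2 ^ (m - n))%N.
    by rewrite ltnW// -ltn_divLR// (ltn_trans jk).
  rewrite {1}/grid (dyadicB m jlt) -[mkset _]/(X (dyadic m j +
    dyadic m (k.+1 * 2 ^ (m - n) - j)) @^-1` eucl_ball y (2 * r)).
  apply: (markov_le hMarkov) => //; try exact: dyadic_ge0; first exact: borel_eucl_ball.
  move=> w Bw; apply: tret; rewrite ?subn_gt0//; last exact: By.
  (* Measured to the end of block [k], the elapsed time is at least [k - blk j] full blocks wherever
     [j] sits in its own block. *)
  rewrite -bE dyadic_le// leq_subRL// mulnBl.
  have := ltn_ceil j b0; have : (j %/ 2 ^ (m - n) * 2 ^ (m - n) <= k * 2 ^ (m - n))%N.
    by rewrite leq_mul2r ltnW ?orbT.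
  by rewrite !mulSn; clear; lia.
Qed.

(** The ball is open, so a visit at time [t] is also a visit at the grid points just after [t]; as
    [s] is finite, one threshold in [m] serves all its blocks. *)
Lemma hit_path n q r y w (s : seq nat) :
  (forall t, 0 <= t -> X s w @[s --> t^'+] --> X t w) ->
  ~ hit_event n q r y w -> uniq s ->
  {in s, forall k, (k < 4 ^ n)%N /\
     exists t, dyadic n k <= t < dyadic n k.+1 /\ eucl_dist (X t w) y < r} ->
  (size s <= q)%N.
Proof.
move=> rc nE us sk; rewrite leqNgt; apply/negP => qs; apply: nE.
have h k : exists m0, k \in s -> forall m, (m0 <= m)%N ->
    w \in hit (grid m) y r (2 ^ (m - n)) k.
  have [ks|nks] := boolP (k \in s); last by exists 0%N.
  have [_ [t [tk ty]]] := sk k ks.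
  have /andP[kt tk1] := tk.
  have t0 : 0 <= t by apply: le_trans kt; exact: dyadic_ge0.
  have gap0 : 0 < r - eucl_dist (X t w) y by rewrite subr_gt0.
  have [m1 h1] := dyadic_above_right t0 (rc _ t0) gap0.
  have gap1 : 0 < (dyadic n k.+1 - t) / 2 by rewrite divr_gt0// subr_gt0.
  have [m2 h2] := pow2N_small (@ltr01 R) gap1.
  exists (maxn n (maxn m1 m2)) => _ m; rewrite !geq_max => /and3P[nm /h1 {}h1 /h2 {}h2].
  apply: mem_set; exists (dyadic_above m t); last first.
    have := eucl_dist_tri (X (dyadic m (dyadic_above m t)) w) (X t w) y.
    by rewrite /grid/=; lra.
  have /andP[l1 _] := dyadic_above_block nm tk.
  (* Blocks are half open: the grid must be so fine that the point after [t] stays strictly before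
     the right end. *)
  have l2 : (dyadic_above m t < k.+1 * 2 ^ (m - n))%N.
    rewrite -(ltr_nat R) -(ltr_pM2r (x := (2 ^+ m)^-1)) ?invr_gt0 ?exprn_gt0//.
    rewrite -/(dyadic m _) -/(dyadic m _) (dyadic_refine _ nm).
    apply: (le_lt_trans (dyadic_above_le m t0)).
    move: h2; rewrite mul1r powRN powR_mulrn//; lra.
  apply/eqP; rewrite /= eqn_leq -ltnS ltn_divLR ?expn_gt0// l2/=.
  by rewrite leq_divRL ?expn_gt0// (leq_trans l1).
have [M hM] := choice h.
apply/liminf_eventP; exists (\max_(k <- s) M k) => m Mm /=.
apply: (leq_trans qs).
have -> : hits (grid m) y r (2 ^ (m - n)) 0 (4 ^ n) w =
    size [seq k <- iota 0 (4 ^ n) | w \in hit (grid m) y r (2 ^ (m - n)) k].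
  by rewrite size_filter -sum1_count big_mkcond /hits /index_iota subn0.
apply: uniq_leq_size => // k ks; rewrite mem_filter mem_iota/= add0n.
have [-> _] := sk k ks; rewrite andbT; apply: (hM k ks m).
by apply: leq_trans Mm; exact: leq_bigmax_seq.
Qed.

Lemma stay_scale : exists2 lambda : R, 3 <= lambda & forall n t z, 0 <= t <= 2 ^- n ->
  (transition P X t z (~` eucl_ball z (lambda * 2 `^ (- (H * n%:R)))) <= (2^-1)%:E)%E.
Proof.
have [beta [C [a1 [b0 C0 a10 tail]]]] := tail_le hMarkov hH hSS hB1.
have e0 : 0 < (2 * C)^-1 by rewrite invr_gt0 mulr_gt0.
have [k1 h1] := pow2N_small b0 e0.
have [k2 h2] := @pow2_absorb R _ (a1 + 3) (@ltr01 R).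
pose k := maxn k1 k2.
have hk2 : a1 + 3 <= 2 `^ k%:R by have := h2 _ (leq_maxr k1 k2); rewrite mul1r.
exists (2 `^ k%:R) => [|n t z tn]; first by move: hk2; lra.
have e : (2 ^- n)^-1 `^ H * (2 `^ k%:R * 2 `^ (- (H * n%:R))) = 2 `^ k%:R :> R.
  rewrite invrK -powR_mulrn// -powRrM mulrCA -pow2D.
  by rewrite (_ : _ + _ = 0) ?powRr0 ?mulr1//; ring.
apply: (le_trans (tail (2 ^- n) _ _ _ _ tn _)); rewrite ?invr_gt0 ?exprn_gt0//.
  by rewrite e; move: hk2; lra.
rewrite lee_fin e -powRrM mulrN (mulrC k%:R) -ler_pdivlMl// [leRHS]mulrC -invfM.
exact: h1 (leq_maxl k1 k2).
Qed.

Hypotheses (hB2 : ball_condition P X) (hHd : 1 <= H * d%:R).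

Lemma return_scale (lambda eta : R) : 0 < lambda -> 0 < eta ->
  exists K : R, 0 <= K /\ exists c : nat -> R,
  [/\ forall k n t (z y : 'rV[R]_d), (0 < k)%N -> dyadic n k <= t ->
        eucl_dist z y < lambda * 2 `^ (- (H * n%:R)) ->
        (transition P X t z (eucl_ball y (2 * (lambda * 2 `^ (- (H * n%:R))))) <= (c k)%:E)%E,
      forall k, 0 <= c k &
      forall n k, (k < 4 ^ n)%N ->
        \sum_(k.+1 <= l < 4 ^ n) 2 * c (l - k)%N <= K * n%:R * 2 `^ (eta * n%:R)].
Proof.
move=> l0 eta0; case: hB2 => eps0 e00 hball.
have d0 : 0 < d%:R :> R.
  by rewrite -(pmulr_rgt0 _ hH) (lt_le_trans ltr01).
(* Small enough for (B2), for [d%:R - eps] to be positive, and for [k%:R]^ (H * eps)[to stay below]2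
   [^ (eta * n%:R)] when [k < 4 ^ n]. *)
pose eps := Num.min (eps0 / 2) (Num.min (d%:R / 2) (eta / (2 * H))).
have eps_gt0 : 0 < eps.
  by rewrite !lt_min !divr_gt0//= mulr_gt0.
have eps_lt : eps < eps0.
  by rewrite (@le_lt_trans _ _ (eps0 / 2))// ?ge_min ?lexx// ; lra.
have eps_d : eps <= d%:R / 2 by rewrite !ge_min lexx orbT.
have eps_eta : eps <= eta / (2 * H) by rewrite !ge_min lexx !orbT.
have [|C1 [C2 [C10 C20 hC]]] := hball eps; first by rewrite eps_gt0.
pose D := d%:R - eps.
have D0 : 0 < D by rewrite /D; lra.
pose K1 := C2 * (2 * lambda) `^ D.
have K10 : 0 <= K1 by rewrite mulr_ge0 ?powR_ge0// ltW.
pose c k := K1 * k%:R `^ (- (H * D)).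
(* A factor 2 from the summand, and [2 * n] from the harmonic sum up to [4 ^ n = 2 ^ (2 * n)]. *)
exists (4 * K1); split; first by rewrite mulr_ge0.
exists c; split=> [k n t z y k0 kt zy|k|n k kn]; first last.
- have HD : 1 - H * eps <= H * D by rewrite /D mulrBr lerD2r.
  have He : 2 * (H * eps) <= eta.
    by move: eps_eta; rewrite ler_pdivlMr ?mulr_gt0//; lra.
  have c_le i : (0 < i)%N -> (i < 4 ^ n)%N -> c i <= K1 * (i%:R^-1 * 2 `^ (eta * n%:R)).
    move=> i0 iN; rewrite /c ler_wpM2l//.
    have i1 : 1 <= i%:R :> R by rewrite ler1n.
    apply: (@le_trans _ _ (i%:R `^ (-1 + H * eps))).
      by apply: ler_powR => //; move: HD; lra.
    rewrite powRD; last by rewrite pnatr_eq0 -lt0n i0 implybT.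
    rewrite powR_inv1// ler_wpM2l ?invr_ge0//.
    have iN' : i%:R <= 2 `^ (2 * n%:R) :> R.
      have e : (4 ^ n = 2 ^ (2 * n))%N by rewrite expnM.
      by rewrite -natrM pow2_nat -natrX -e ler_nat ltnW.
    apply: (@le_trans _ _ (2 `^ (2 * n%:R) `^ (H * eps))).
      apply: ge0_ler_powR; rewrite ?nnegrE ?powR_ge0// mulr_ge0// ltW//.
    rewrite -powRrM le_pow2// mulrAC ler_wpM2r//.
  rewrite -[k.+1]add1n big_addn.
  apply: (@le_trans _ _ (\sum_(1 <= i < 4 ^ n - k) 2 * K1 * 2 `^ (eta * n%:R) * i%:R^-1)).
    rewrite big_nat [leRHS]big_nat; apply: ler_sum => i /andP[i0 iN].
    have /(c_le _ i0) ci : (i < 4 ^ n)%N by rewrite (leq_trans iN)// leq_subr.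
    rewrite addnK (_ : _ * i%:R^-1 = 2 * (K1 * (i%:R^-1 * 2 `^ (eta * n%:R)))); last by ring.
    by rewrite ler_pM2l.
  rewrite -mulr_sumr.
  apply: (@le_trans _ _ (2 * K1 * 2 `^ (eta * n%:R) * (2 * n)%:R)); last first.
    by rewrite natrM le_eqVlt; apply/orP; left; apply/eqP; ring.
  rewrite (ler_wpM2l (mulr_ge0 (mulr_ge0 (ler0n R 2) K10) (powR_ge0 _ _)))//.
  apply: (le_trans _ (@harmonic_le R (2 * n))).
  rewrite expnM (big_cat_nat (n := 4 ^ n - k) (p := ((2 ^ 2) ^ n)%N))//= ?leq_subr ?subn_gt0//.
  by rewrite lerDl sumr_ge0// => i _; rewrite invr_ge0.
- by rewrite mulr_ge0 ?powR_ge0.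
- have k0' : 0 < k%:R :> R by rewrite ltr0n.
  have kn0 : 0 < dyadic n k :> R by rewrite divr_gt0// exprn_gt0.
  have t0 : 0 < t by exact: lt_le_trans kt.
  have ti0 : 0 < t^-1 `^ H by rewrite powR_gt0// invr_gt0.
  have r0 : 0 < lambda * 2 `^ (- (H * n%:R)) by rewrite mulr_gt0 ?pow2_gt0.
  rewrite (transition_ball hSS)//.
  set rho := t^-1 `^ H * _.
  have rho0 : 0 < rho by rewrite !mulr_gt0// pow2_gt0.
  have dist_rho : eucl_dist (t^-1 `^ H *: z) (t^-1 `^ H *: y) <= rho.
    by rewrite eucl_distZ ?(ltW ti0)// ler_pM2l//; move: zy r0; lra.
  have /andP[_ h] := hC _ _ _ rho0 dist_rho.
  apply: (le_trans h); rewrite lee_fin /c /K1 -mulrA ler_pM2l//.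
  apply: (@le_trans _ _ (rho `^ D)); first by rewrite ge_min lexx orbT.
  have rho_le : rho <= 2 * lambda * k%:R `^ (- H).
    apply: (@le_trans _ _ ((dyadic n k)^-1 `^ H * (2 * (lambda * 2 `^ (- (H * n%:R)))))).
      rewrite ler_pM2r ?mulr_gt0 ?pow2_gt0//; apply: ge0_ler_powR; first exact: ltW.
      - by rewrite nnegrE invr_ge0 ltW.
      - by rewrite nnegrE invr_ge0 ltW.
      by rewrite lef_pV2.
    rewrite /dyadic invfM invrK powRM ?invr_ge0 ?exprn_ge0//.
    rewrite -powR_mulrn// -powRrM -powR_inv1// -powRrM mulN1r.
    rewrite (_ : _ * _ = 2 * lambda * k%:R `^ (- H) *
      (2 `^ (n%:R * H) * 2 `^ (- (H * n%:R)))); last by ring.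
    by rewrite -pow2D (_ : _ + _ = 0) ?powRr0 ?mulr1//; ring.
  apply: (@le_trans _ _ ((2 * lambda * k%:R `^ (- H)) `^ D)).
    by apply: ge0_ler_powR; rewrite ?nnegrE ?(ltW rho0) ?(ltW D0) ?mulr_ge0 ?powR_ge0 ?(ltW l0).
  by rewrite powRM ?mulr_ge0 ?powR_ge0 ?(ltW l0)// -powRrM mulNr.
Qed.

Lemma returns_ae x (eta : R) : 0 < eta -> exists lambda C : R, 3 <= lambda /\
  {ae P x, forall w, exists n0, forall n, (n0 <= n)%N -> exists q, q%:R <= C * 2 `^ (eta * n%:R) /\
    forall v : 'rV[R]_d, (forall i, `|v ord0 i| <= 2 ^+ n) ->
    exists y, eucl_dist v y <= 2 `^ (- (H * n%:R)) /\
      ~ hit_event n q (lambda * 2 `^ (- (H * n%:R))) y w}.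
Proof.
move=> eta0.
have d0 : 0 < d%:R :> R by rewrite -(pmulr_rgt0 _ hH) (lt_le_trans ltr01).
have [lambda l3 hstay] := stay_scale.
have l0 : 0 < lambda by rewrite (lt_le_trans _ l3).
have eta4 : 0 < eta / 4 by rewrite divr_gt0.
have [K [K0 [c [hret c0 hc]]]] := return_scale l0 eta4.
have [n1 h1] := @pow2_linear R K _ eta4.
have [n2 h2] := @pow2_absorb R _ (2 * d%:R + 2) (@ltr01 R).
(* The net has at most [2]^ (e * n%:R)[points: the ratio of the cube's size to the mesh has order]2
   [^ ((1 + H) * n%:R)] per coordinate, and one more power [2 ^ n] absorbs the constants. The number
   [p] of rounds is chosen to beat it. *)
pose e : R := (2 + H) * d%:R.
pose p := (Num.truncn ((e + 2) / (eta / 2))).+1.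
have p_ge : e + 2 <= eta / 2 * p%:R.
  by rewrite mulrC -ler_pdivrMr ?divr_gt0// ltW// truncnS_gt.
pose Q n := (Num.truncn (2 `^ (eta * n%:R) : R)).+1.
pose r n := lambda * 2 `^ (- (H * n%:R)).
(* The division by [d] compensates the factor [d] lost in [lattice_approx]. *)
pose h n := 2 `^ (- (H * n%:R)) / d%:R.
have h0 n : 0 < h n by rewrite divr_gt0 ?pow2_gt0.
pose B n := (Num.truncn (2 ^+ n / h n)).+1.
pose net n (z : {ffun 'I_d -> 'I_(2 * B n)}) := lattice_point (h n) (B n) (fun i => z i : nat).
pose E n := \bigcup_(z in [set: {ffun 'I_d -> 'I_(2 * B n)}])
  hit_event n (p * Q n) (r n) (net n z).
have mE n : measurable (E n).
  by apply: fin_bigcup_measurable => // z _; exact: measurable_hit_event.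
have ae := @borel_cantelli _ _ _ (P x) E (maxn 1%N (maxn n1 n2)) mE.
exists lambda, (2 * p%:R); split=> //; apply: filterS (ae _).
  move=> w [n0 hn0]; exists n0 => n /hn0 nE; exists (p * Q n)%N; split.
    rewrite natrM (mulrC 2) -mulrA ler_wpM2l// /Q -natr1 mulrDl mul1r lerD//.
      by rewrite truncn_le powR_ge0.
    by rewrite -[leLHS](powRr0 2) le_pow2// mulr_ge0// ltW.
  move=> v vn; have vB i : `|v ord0 i| < h n * (B n)%:R.
    by rewrite (le_lt_trans (vn i))// mulrC -ltr_pdivrMr// truncnS_gt.
  have [z hz] := lattice_approx (h0 n) vB; exists (net n z); split.
    by apply: (le_trans hz); rewrite /h mulrC divfK// gt_eqF.
  by move=> Ez; apply: nE; exists z.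
move=> n; rewrite !geq_max => /and3P[n_gt0 n1n n2n].
pose M : R := 2 `^ (eta / 2 * n%:R).
apply: (@le_trans _ _ (#|{ffun 'I_d -> 'I_(2 * B n)}|%:R * (M / (Q n)%:R) ^+ p)%:E).
  apply: union_bound => z; first exact: measurable_hit_event.
  apply: (hit_event_le _ _ _ (c := c)) => //.
  - by rewrite mulr_gt0 ?pow2_gt0.
  - exact: powR_ge0.
  - by move=> t z'; exact: hstay.
  - by move=> k t z'; exact: hret.
  - move=> k kn; apply: (le_trans (hc n k kn)); rewrite /M.
    rewrite (_ : eta / 2 * n%:R = eta / 4 * n%:R + eta / 4 * n%:R); last by field.
    by rewrite pow2D ler_wpM2r ?powR_ge0// h1.
rewrite lee_fin card_ffun !card_ord natrX.
have nR : 1 <= n%:R :> R by rewrite ler1n.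
have B_le : (2 * B n)%:R <= 2 `^ ((2 + H) * n%:R) :> R.
  have Hn0 : 0 <= (1 + H) * n%:R by rewrite mulr_ge0// addr_ge0// ltW.
  have one_le : 1 <= 2 `^ ((1 + H) * n%:R) :> R.
    by rewrite -[leLHS](powRr0 2) le_pow2.
  have hE : 2 ^+ n / h n = d%:R * 2 `^ ((1 + H) * n%:R).
    rewrite /h invf_div -powRN opprK mulrCA -pow2_nat -pow2D mulrDl mul1r//.
  have BE : (B n)%:R = (Num.truncn (2 ^+ n / h n))%:R + 1 :> R by rewrite natr1.
  rewrite natrM BE; apply: (@le_trans _ _ ((2 * d%:R + 2) * 2 `^ ((1 + H) * n%:R))).
    rewrite [leLHS]mulrDr mulr1 [leRHS]mulrDl lerD//; last by rewrite ler_peMr.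
    rewrite -mulrA ler_pM2l// -hE truncn_le divr_ge0 ?exprn_ge0// ltW//.
  rewrite (_ : (2 + H) * n%:R = 1 * n%:R + (1 + H) * n%:R); last by ring.
  by rewrite pow2D ler_wpM2r ?powR_ge0// h2.
have MQ : M / (Q n)%:R <= 2 `^ (- (eta / 2 * n%:R)).
  rewrite ler_pdivrMr ?ltr0n//.
  apply: (@le_trans _ _ (2 `^ (- (eta / 2 * n%:R)) * 2 `^ (eta * n%:R))).
    by rewrite -pow2D le_pow2// le_eqVlt; apply/orP; left; apply/eqP; field.
  by rewrite ler_wpM2l ?powR_ge0// ltW// truncnS_gt.
have B_pow : (2 * B n)%:R ^+ d <= 2 `^ (e * n%:R) :> R.
  rewrite /e mulrAC powRrM powR_mulrn ?powR_ge0//.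
  by apply: lerXn2r; rewrite ?nnegrE ?powR_ge0.
have MQ_pow : (M / (Q n)%:R) ^+ p <= 2 `^ (- (eta / 2 * p%:R * n%:R)).
  rewrite mulrAC -mulNr powRrM powR_mulrn ?powR_ge0//.
  by apply: lerXn2r; rewrite ?nnegrE ?powR_ge0// divr_ge0// powR_ge0.
apply: (@le_trans _ _ (2 `^ (e * n%:R) * 2 `^ (- (eta / 2 * p%:R * n%:R)))).
  by apply: ler_pM => //; rewrite ?exprn_ge0 ?divr_ge0 ?powR_ge0.
rewrite -pow2D -powR_mulrn// -powRN; apply: le_pow2.
have : (e + 2) * n%:R <= eta / 2 * p%:R * n%:R by rewrite ler_wpM2r.
rewrite -natr1 mulrDl; move: (e * n%:R) (eta / 2 * p%:R * n%:R) => u v; lra.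
Qed.

End PathProperties.

(** * Dimensions of the image *)

Section RealDist.
Context {R : realType}.
Implicit Types s t u : R.

Lemma real_distxx s : real_dist s s = 0.
Proof. by rewrite /real_dist subrr normr0. Qed.

Lemma real_distC s t : real_dist s t = real_dist t s.
Proof. exact: distrC. Qed.

Lemma real_dist_tri s t u : real_dist s u <= real_dist s t + real_dist t u.
Proof. exact: ler_distD. Qed.

End RealDist.

(** * From scale bounds on countably many pieces to dimensions *)

Section DimensionTransfer.
Context {R : realType} {I : eqType} {T1 T2 : Type} (i0 : I).
Variables (dist1 : T1 -> T1 -> R) (dist2 : T2 -> T2 -> R).
Hypothesis dist1xx : forall x, dist1 x x = 0.
Hypothesis dist1C : forall x y, dist1 x y = dist1 y x.
Hypothesis dist1_tri : forall x y z, dist1 x z <= dist1 x y + dist1 y z.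
Hypothesis dist2xx : forall x, dist2 x x = 0.
Hypothesis dist2C : forall x y, dist2 x y = dist2 y x.
Hypothesis dist2_tri : forall x y z, dist2 x z <= dist2 x y + dist2 y z.
Variables (f1 : I -> T1) (f2 : I -> T2) (theta : R) (E : set I) (EL : nat -> set I).
Hypothesis theta0 : 0 < theta.
Hypothesis EEL : E = \bigcup_L EL L.
Hypothesis ELbound : forall s s', 0 < s -> theta * s < s' -> exists a b eta,
  [/\ 0 < a, 0 < b, eta + a * s < b * s' &
      forall L, scale_bound dist1 dist2 f1 f2 a b eta (EL L)].

Let sub L : f1 @` EL L `<=` f1 @` E.
Proof. by rewrite EEL => _ [t Et <-]; exists t => //; exists L. Qed.

(** The scale exponents may depend on [s] and [s']: the strict inequality [theta * s < s'] leaves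
    room for bounds that only approach the ratio [theta]. Countable stability of null sets puts the
    pieces together. *)
Lemma hausdorff_dim_le :
  (hausdorff_dim dist2 (f2 @` E) <= theta%:E * hausdorff_dim dist1 (f1 @` E))%E.
Proof.
apply: inf_null_le => // s s' s0 ss' E0.
have [a [b [eta [a0 b0 abs hL]]]] := ELbound s0 ss'.
have s'0 : 0 < s' by apply: lt_trans ss'; rewrite mulr_gt0.
rewrite EEL image_bigcup; apply: hausdorff_null_bigcup => L.
apply: (hausdorff_transfer dist2C dist2_tri a0 b0 s0 s'0 (ltW abs) (hL L)).
exact: (hausdorff_null_sub (@sub L) E0).
Qed.

Lemma packing_dim_le :
  (packing_dim dist2 (f2 @` E) <= theta%:E * packing_dim dist1 (f1 @` E))%E.
Proof.
apply: inf_null_le => // s s' s0 ss' E0.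
have [a [b [eta [a0 b0 abs hL]]]] := ELbound s0 ss'.
have s'0 : 0 < s' by apply: lt_trans ss'; rewrite mulr_gt0.
rewrite EEL image_bigcup; apply: (packing_null_bigcup (f2 i0)) => L.
apply: (packing_transfer i0 dist1xx dist1C dist1_tri dist2xx a0 b0 s0 s'0 abs (hL L)).
exact: (packing_null_sub (f1 i0) (@sub L) E0).
Qed.

End DimensionTransfer.

Lemma pairwise_in {I : eqType} (r : rel I) (s : seq I) : symmetric r ->
  pairwise r s -> {in s &, forall x y, x != y -> r x y}.
Proof.
move=> rC ps x y xs ys xy.
have ixy : index x s != index y s.
  by apply: contraNneq xy => ij; rewrite -(nth_index x xs) ij nth_index.
have h u v : u \in s -> v \in s -> (index u s < index v s)%N -> r u v.
  move=> us vs uv; rewrite -(nth_index x us) -(nth_index x vs).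
  by apply: (pairwiseP x ps); rewrite // inE index_mem.
by move: ixy; rewrite neq_ltn => /orP[/h|/h]; [|rewrite rC]; exact.
Qed.


(** * Scale bounds along one path *)

Section Paths.
Context {R : realType} {d : nat} {dO : measure_display} {Omega : measurableType dO}.
Variables (X : R -> Omega -> 'rV[R]_d) (w : Omega).
Hypothesis rc : forall t, 0 <= t -> X s w @[s --> t^'+] --> X t w.

(* The covering properties hold for times and positions at most [2^n] at level
   [n]; countable stability of the dimensions removes this restriction. *)
Definition window (E : set R) (L : nat) : set R :=
  [set t | [/\ E t, 0 <= t, t < 2 ^+ L & forall i, `|X t w ord0 i| <= 2 ^+ L]].

Let blk n (t : R) := Num.truncn (t * 2 ^+ n).

Let blk_lt n L t : (L <= n)%N -> 0 <= t -> t < 2 ^+ L -> (blk n t < 4 ^ n)%N.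
Proof.
move=> Ln t0 tL; rewrite /blk truncn_lt_nat ?mulr_ge0 ?exprn_ge0//.
have -> : (4 ^ n = 2 ^ n * 2 ^ n)%N by rewrite -expnMn.
rewrite natrM natrX ltr_pM2r ?exprn_gt0// (lt_le_trans tL)// ler_eXn2l// ltr1n//.
Qed.

(** Times within [2 ^- n] of each other meet at most three adjacent dyadic intervals, and each
    contains at most [K] of them: [K.+1] times with mutually distant positions would produce [K]
    successive large jumps. *)
Lemma escape_scale_bound E L (gamma : R) K n0 :
  (forall n, (n0 <= n)%N -> forall k, (k < 4 ^ n)%N ->
    ~ escape_event X n (2 `^ (- (gamma * n%:R)) / 8) K k w) ->
  scale_bound (@real_dist R) (@eucl_dist R d) id (fun t => X t w) 1 gamma 0 (window E L).
Proof.
move=> nE; exists (3 * K%:R), (maxn n0 L) => n; rewrite geq_max => /andP[n0n Ln] s sE s1 s2.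
rewrite mul0r powRr0 mulr1.
have [->|[t0 t0s]] : s = [::] \/ exists t0, t0 \in s.
  by case: (s) => [|t0 s']; [left|right; exists t0; rewrite mem_head].
  by rewrite mulr_ge0.
pose rho := 2 `^ (- (gamma * n%:R)) : R.
pose r t t' := rho < eucl_dist (X t w) (X t' w).
have rC : symmetric r by move=> t t'; rewrite /r eucl_distC.
have us : uniq s.
  by apply: pairwise_uniq s2 => t; rewrite eucl_distxx ltNge powR_ge0.
have sr := pairwise_in rC s2.
have cnt k : (count (fun t => blk n t == k) s <= K)%N.
  rewrite leqNgt -size_filter; apply/negP => Ku.
  (* Sorted, because [escape_path] follows the path in the order of time. *)
  pose u := [seq t <- s | blk n t == k]; rewrite -/u in Ku; pose v := sort <=%R u.
  have vE t : t \in v -> t \in s /\ blk n t = k.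
    by rewrite mem_sort mem_filter => /andP[/eqP].
  have sv : size v = size u by rewrite size_sort.
  have uv : uniq v by rewrite sort_uniq filter_uniq.
  have vs l : (l <= K)%N -> nth 0 v l \in v.
    by move=> lK; rewrite mem_nth// sv (leq_ltn_trans lK).
  have k4 : (k < 4 ^ n)%N.
    have [vs0 <-] := vE _ (vs 0%N (leq0n _)).
    by have [_ t_ge0 tL _] := sE _ vs0; exact: (blk_lt Ln).
  have a0 : 0 < rho / 8 by rewrite divr_gt0// pow2_gt0.
  have [l lK|l lK|l lK] := escape_path a0 rc (nE n n0n k k4) (T := nth 0 v).
  - have [ts <-] := vE _ (vs l lK); have [_ t_ge0 _ _] := sE _ ts.
    exact: dyadic_block.
  - have /sortedP h : sorted <=%R v by apply: sort_sorted => x y; exact: le_total.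
    by apply: h; rewrite sv (leq_ltn_trans lK).
  - apply/negP; rewrite -ltNge mulrC divfK//.
    have [ts _] := vE _ (vs l (ltnW lK)); have [ts' _] := vE _ (vs l.+1 lK).
    apply: sr => //; rewrite nth_uniq// ?gtn_eqF// sv.
      by rewrite (leq_ltn_trans lK).
    by rewrite (leq_ltn_trans (ltnW lK)).
pose k0 := blk n t0.
(* For [k0 = 0] the predecessor repeats the block 0, which only enlarges the sum. *)
have three : (size s <= \sum_(k <- [:: k0.-1; k0; k0.+1]) count (fun t => blk n t == k) s)%N.
  apply: (@size_le_sum_count _ _ (fun k t => blk n t == k)) => t ts.
  exists (blk n t) => //.
  have [_ t_ge0 _ _] := sE _ ts; have [_ t0_ge0 _ _] := sE _ t0s.
  have /andP[l1 l2] := dyadic_block n t_ge0; have /andP[l3 l4] := dyadic_block n t0_ge0.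
  have := s1 _ _ ts t0s; rewrite mul1r powRN powR_mulrn//= /real_dist ler_distl => /andP[l5 l6].
  have p0 : 0 < 2 ^+ n :> R by rewrite exprn_gt0.
  have q1 : (blk n t < k0.+2)%N.
    rewrite -(ltr_nat R) -(ltr_pM2r (x := (2 ^+ n)^-1)) ?invr_gt0//.
    rewrite -natr1 mulrDl mul1r -/(dyadic n (blk n t)) -/(dyadic n k0.+1).
    by move: l1 l4 l6; rewrite -/(blk n t) -/k0; lra.
  have q2 : (k0 < (blk n t).+2)%N.
    rewrite -(ltr_nat R) -(ltr_pM2r (x := (2 ^+ n)^-1)) ?invr_gt0//.
    rewrite -[(_.+2)%:R]natr1 mulrDl mul1r -/(dyadic n (blk n t).+1) -/(dyadic n k0).
    by move: l2 l3 l5; rewrite -/(blk n t) -/k0; lra.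
  by rewrite !inE; move: q1 q2; clear; move: (blk n t) => b; lia.
rewrite -natrM ler_nat (leq_trans three)// !big_cons big_nil addn0.
by rewrite (_ : (3 * K = K + (K + K))%N) ?leq_add//; lia.
Qed.

Lemma hit_scale_bound E L (H eta lambda C : R) n0 : 3 <= lambda ->
  (forall n, (n0 <= n)%N -> exists q, q%:R <= C * 2 `^ (eta * n%:R) /\
    forall v : 'rV[R]_d, (forall i, `|v ord0 i| <= 2 ^+ n) ->
    exists y, eucl_dist v y <= 2 `^ (- (H * n%:R)) /\
      ~ hit_event X n q (lambda * 2 `^ (- (H * n%:R))) y w) ->
  scale_bound (@eucl_dist R d) (@real_dist R) (fun t => X t w) id H 1 eta (window E L).
Proof.
move=> l3 hq; exists C, (maxn n0 L) => n; rewrite geq_max => /andP[n0n Ln] s sE s1 s2.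
have [q [qC hv]] := hq n n0n.
have [->|[t0 t0s]] : s = [::] \/ exists t0, t0 \in s.
  by case: (s) => [|t0 s']; [left|right; exists t0; rewrite mem_head].
  by rewrite (le_trans _ qC)//.
apply: le_trans qC; rewrite ler_nat.
have [_ _ _ vL] := sE _ t0s.
have [i|y [yv nE]] := hv (X t0 w).
  by rewrite (le_trans (vL i))// ler_eXn2l// ltr1n//.
have rC : symmetric (fun t t' : R => 2 `^ (- (1 * n%:R)) < real_dist t t').
  by move=> t t'; rewrite real_distC.
have us : uniq s.
  by apply: pairwise_uniq s2 => t; rewrite real_distxx ltNge powR_ge0.
have sr := pairwise_in rC s2.
rewrite -(size_map (blk n)); apply: (hit_path rc nE).
  rewrite map_inj_in_uniq// => t t' ts t's tt'; apply/eqP.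
  apply: contraT => /(sr _ _ ts t's); rewrite mul1r powRN powR_mulrn//.
  have [_ t_ge0 _ _] := sE _ ts; have [_ t'_ge0 _ _] := sE _ t's.
  have /andP[l1 l2] := dyadic_block n t_ge0; have /andP[l3' l4] := dyadic_block n t'_ge0.
  move: l3' l4; rewrite -/(blk n t') -tt' => l3' l4.
  have eS : dyadic n (blk n t).+1 = dyadic n (blk n t) + 2 ^- n :> R.
    by rewrite /dyadic -natr1 mulrDl mul1r.
  rewrite /real_dist ltNge ler_distl; move: l1 l2 l3' l4; rewrite -/(blk n t) eS.
  by move=> h1 h2 h3 h4 /negP[]; apply/andP; split; lra.
move=> _ /mapP[t ts ->]; have [_ t_ge0 tL _] := sE _ ts; split; first exact: blk_lt tL.
exists t; split; first exact: dyadic_block.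
have := eucl_dist_tri (X t w) (X t0 w) y; have := s1 _ _ ts t0s; move: yv l3.
have := @pow2_gt0 R (- (H * n%:R)); move: (2 `^ _) => u u0 yv l3' tt0 tri.
have : 3 * u <= lambda * u by rewrite ler_pM2r.
by move: u0 yv tt0 tri => /= *; lra.
Qed.

Lemma window_cover E : E `<=` `[0, +oo[%classic -> E = \bigcup_L window E L.
Proof.
move=> E0; apply/seteqP; split=> [t Et|t [L _ []]//].
have t0 : 0 <= t by have := E0 t Et; rewrite /= in_itv/= andbT.
have [L tL] : exists L, t + eucl_norm (X t w) < 2 ^+ L.
  exists (Num.truncn (t + eucl_norm (X t w))).+1; apply: (lt_trans (truncnS_gt _)).
  by rewrite -natrX ltr_nat ltn_expl.
have n0 := eucl_norm_ge0 (X t w).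
exists L; first by []; split; [exact: Et|exact: t0|move: tL; lra|].
by move=> i; have := coord_le_eucl_norm (X t w) i; move: tL; lra.
Qed.

End Paths.

Unset Implicit Arguments.

Theorem theorem4p1 (R : realType) (d : nat) (dO : measure_display)
  (Omega : measurableType dO) (P : 'rV[R]_d -> probability Omega R)
  (X : R -> Omega -> 'rV[R]_d) (F : R -> set (set Omega)) (H : R)
  (hMarkov : markov_process P X F) (hStrong : strong_markov P X F)
  (hSep : separable_process P X) (hCadlag : cadlag P X)
  (hH : 0 < H) (hSS : self_similar P X H)
  (hB1 : tail_condition P X) (hB2 : ball_condition P X)
  (hHd : 1 <= H * d%:R) :
  forall x : 'rV[R]_d,
    {ae P x, forall w, forall E : set R, measurable E -> E `<=` `[0, +oo[ ->
      hausdorff_dim (@eucl_dist R d) [set X t w | t in E] =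
        ((H^-1)%:E * hausdorff_dim (@real_dist R) E)%E /\
      packing_dim (@eucl_dist R d) [set X t w | t in E] =
        ((H^-1)%:E * packing_dim (@real_dist R) E)%E}.
Proof.
move=> x.
(* A countable family increasing to [H], so that one null set serves all exponents; [j.+2] keeps the
   first term positive. *)
pose gamma (j : nat) : R := H * (1 - j.+2%:R^-1).
have gammaH j : 0 < gamma j < H.
  have j0 : 0 < j.+2%:R^-1 :> R by rewrite invr_gt0.
  have j1 : j.+2%:R^-1 < 1 :> R by rewrite invf_lt1// ltr1n.
  by rewrite /gamma mulr_gt0 ?subr_gt0//= gtr_pMr// gtrBl.
have aeU : {ae P x, forall w, forall j, exists K n0, forall n, (n0 <= n)%N ->
    forall k, (k < 4 ^ n)%N -> ~ escape_event X n (2 `^ (- (gamma j * n%:R)) / 8) K k w}.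
  by apply: ae_foralln => j; exact: (increments_ae hMarkov hH hSS hB1 x (gammaH j)).
have etaj j : 0 < j.+1%:R^-1 :> R by rewrite invr_gt0.
have aeL : {ae P x, forall w, forall j : nat, exists lambda C : R, 3 <= lambda /\
    exists n0, forall n, (n0 <= n)%N -> exists q, q%:R <= C * 2 `^ (j.+1%:R^-1 * n%:R) /\
      forall v : 'rV[R]_d, (forall i, `|v ord0 i| <= 2 ^+ n) ->
      exists y, eucl_dist v y <= 2 `^ (- (H * n%:R)) /\
        ~ hit_event X n q (lambda * 2 `^ (- (H * n%:R))) y w}.
  apply: ae_foralln => j.
  have [lambda [C [l3 hw]]] := returns_ae hMarkov hH hSS hB1 hB2 hHd x (etaj j).
  by apply: filterS hw => w [n0 hn0]; exists lambda, C; split=> //; exists n0.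
(* The almost sure events are fixed before [E] is introduced, which gives the simultaneity in
   [E]. *)
move: (hCadlag x) aeU aeL; apply: filterS3 => w [rc _] hU hL E _ E0.
have EE := window_cover X w E0.
have Hi0 : 0 < H^-1 by rewrite invr_gt0.
have up s s' : 0 < s -> H^-1 * s < s' -> exists a b eta,
    [/\ 0 < a, 0 < b, eta + a * s < b * s' &
      forall L, scale_bound (@real_dist R) (@eucl_dist R d) id (fun t => X t w) a b eta
        (window X w E L)].
  move=> s0 ss'; have sHs' : s < H * s' by rewrite -ltr_pdivrMl.
  have s'0 : 0 < s' by apply: lt_trans ss'; rewrite mulr_gt0.
  have gap0 : 0 < H * s' - s by rewrite subr_gt0.
  (* The requirement [s < gamma j * s'] amounts to [H * s' / j.+2%:R < H * s' - s]. *)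
  pose j := Num.truncn (H * s' / (H * s' - s)).
  have hj : H * s' < (H * s' - s) * j.+2%:R.
    by rewrite [ltRHS]mulrC -ltr_pdivrMr// (lt_trans (truncnS_gt _))// ltr_nat.
  exists 1, (gamma j), 0; have [gj _] := andP (gammaH j); split=> //.
    rewrite add0r mul1r /gamma mulrAC mulrBr mulr1 ltrBrDr -ltrBrDl.
    by rewrite ltr_pdivrMr.
  by have [K [n0 hK]] := hU j => L; exact: (escape_scale_bound rc E L hK).
have down s s' : 0 < s -> H * s < s' -> exists a b eta,
    [/\ 0 < a, 0 < b, eta + a * s < b * s' &
      forall L, scale_bound (@eucl_dist R d) (@real_dist R) (fun t => X t w) id a b eta
        (window X w E L)].
  move=> s0 ss'; have gap0 : 0 < s' - H * s by rewrite subr_gt0.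
  pose j := Num.truncn (s' - H * s)^-1.
  exists H, 1, j.+1%:R^-1; split=> //.
    rewrite mul1r -ltrBrDr invf_plt ?posrE//; exact: truncnS_gt.
  by have [lambda [C [l3 [n0 hn0]]]] := hL j => L; exact: (hit_scale_bound rc E L l3 hn0).
split; apply/eqP; rewrite eq_le; apply/andP; split.
- by have := hausdorff_dim_le (@eucl_distC R d) (@eucl_dist_tri R d) Hi0 EE up; rewrite image_id.
(* The lower bound becomes an upper bound for the dimension of [E] by [H] times that of its image,
   with the two spaces exchanged. *)
- rewrite lee_pdivrMl//.
  by have := hausdorff_dim_le (@real_distC R) (@real_dist_tri R) hH EE down; rewrite image_id.
- have := packing_dim_le 0 (@real_distxx R) (@real_distC R) (@real_dist_tri R)
    (@eucl_distxx R d) Hi0 EE up.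
  by rewrite image_id.
- rewrite lee_pdivrMl//.
  have := packing_dim_le 0 (@eucl_distxx R d) (@eucl_distC R d) (@eucl_dist_tri R d)
    (@real_distxx R) hH EE down.
  by rewrite image_id.
Qed.
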